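(* Let $K$ be a field of characteristic $0$, let $(r,s)\in\mathbb{Z}^2$ with $s\neq 0$ and $\nu=r+s>0$, and let $L=K(\alpha)$ with $\alpha$ an indeterminate. For $k\ge 0$ put $d_k=s^{-k}\prod_{i=0}^{k-1}(1-i\nu)$ (so $d_0=1$). For integers $i\le 1$ define $\delta_i\in\mathrm{End}_{K\text{-lin}}(L)$ by $$\delta_i=\begin{cases}\dfrac{d_k}{k!}\left(\dfrac{d}{d\alpha}\right)^k, & i=1-k\nu\text{ with }k\ge 0,\\[2mm] 0,& i\not\equiv 1\ (\mathrm{mod}\ \nu).\end{cases}$$ Then the operators $\delta_i$, $i\in\mathbb{Z}_{\le 0}$, satisfy, for all $i\le 0$ and $a,b\in L$, $$\delta_i(ab)=a\,\delta_i(b)+\delta_i(a)\,b+\sum_{k>0}\ \sum_{\substack{l,j_1,\dots,j_k\in\mathbb{Z}_{\le 0}\\ j_1+\cdots+j_k-k+l=i}}\binom{l}{k}\,\delta_l(a)\,\delta_{j_1}\cdots\delta_{j_k}(b),$$ so there exists a multiplication $\tilde\delta$ on $L((T^{-1}))$ such that $$T\cdot f=f\cdot T+\sum_{k=1}^\infty\delta_{1-k\nu}(f)\cdot T^{1-k\nu}=f\cdot T+s^{-1}f'T^{1-\nu}+\frac{1}{2!}\frac{1-\nu}{s^2}f^{(2)}T^{1-2\nu}+\cdots,\qquad f\in L,$$ and $L((T^{-1};\tilde\delta))$ is a deformed Laurent series ring. The multiplication in this ring is given by $$\sum_{i\le m}a_iT^i\cdot\sum_{j\le n}b_jT^j=\sum_{i\le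 m,\,j\le n}a_iT^i\cdot b_jT^j,\qquad a_iT^i\cdot b_jT^j=\sum_{k\ge 0}\lambda_i^k\,a_i\,b_j^{(k)}\,T^{i-k\nu+j},$$ where $\lambda_i^0=1$ and, for $k>0$, $$\lambda_i^k=\left(\frac{\nu}{s}\right)^k\sum_{l=1}^k(-1)^{k-l}\binom{i}{l}\binom{i-l-1}{k-l}\binom{l\nu^{-1}}{k}.$$ In particular, if $(r,s)=(0,1)$ then $\lambda_i^k=\binom{i}{k}$.
   Context: For a field $L$, $L((T^{-1}))=\{\sum_{i\le k} a_iT^i : a_i\in L,\ k\in\mathbb{Z}\}$ is the left $L$-vector space of (inverse) formal Laurent series. The standard degree map is $\deg 0=-\infty$, $\deg(\sum_{i\le k}a_iT^i)=k$ if $a_k\neq 0$. The topology is induced by the metric $d(f,g)=e^{\deg(f-g)}$. A deformed Laurent series ring (with the standard degree map) $L((T^{-1};\tilde\delta))$ is $L((T^{-1}))$ with its usual addition, standard degree map and topology, together with a multiplication $\tilde\delta:(f,g)\mapsto f\cdot g$ such that: (i) the multiplication is associative, distributive over addition, and continuous; (ii) $b\cdot \sum_{i\le k}a_iT^i=\sum_{i\le k}(ba_i)T^i$ for $b\in L$; (iii) $T^i\cdot T^j=T^{i+j}$ for $i,j\in\mathbb{Z}$ (with $T^0=1$); (iv) $\deg(f\cdot g)=\deg f+\deg g$ for all $f,g$. For a rational number $a$ and integer $k\ge 0$, $\binom{a}{k}=a(a-1)\cdots(a-k+1)/k!$, with $\binom a0=1$. $f^{(k)}$ is the $k$-th derivative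 of $f\in K(\alpha)$ with respect to $\alpha$. In $\lambda_i^k$ the $k$ is a superscript index, not an exponent. *)

(* Defs.v *)
(* MathComp-Analysis development; the metric takes its values in Stdlib's [R],
   which Rstruct makes a [realType]. *)
From HB Require Import structures.
From mathcomp Require Import all_boot all_order all_algebra.
From mathcomp Require Import finmap.
From mathcomp Require Import all_classical all_reals.
From mathcomp Require Import topology sequences exp.
From mathcomp Require Import Rstruct Rstruct_topology.
From mathcomp Require summability.
From mathcomp Require Import zify ring.

Set Implicit Arguments.
Unset Strict Implicit.
Unset Printing Implicit Defensive.

Import Order.TTheory GRing.Theory Num.Theory.

Local Open Scope classical_set_scope.
Local Open Scope ring_scope.

(* The field K(alpha), as a commutative K-algebra, with alpha = 'X. *)
Section RationalFunctions.
Variable K : fieldType.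

Definition ratfun := {fraction {poly K}}.
HB.instance Definition _ := GRing.Field.on ratfun.

Implicit Types (c : K) (p q : {poly K}) (f g : ratfun).

Definition ratfun_poly : {poly K} -> ratfun := @FracField.tofrac {poly K}.
HB.instance Definition _ := GRing.RMorphism.copy ratfun_poly
  (@FracField.tofrac {poly K}).

Fact ratfun_polyM p q : ratfun_poly (p * q) = ratfun_poly p * ratfun_poly q.
Proof. exact: tofracM. Qed.

Fact ratfun_polyD p q : ratfun_poly (p + q) = ratfun_poly p + ratfun_poly q.
Proof. exact: tofracD. Qed.

Definition ratfun_scale c f : ratfun := ratfun_poly c%:P * f.

Fact ratfun_scaleA c d f :
  ratfun_scale c (ratfun_scale d f) = ratfun_scale (c * d) f.
Proof. by rewrite /ratfun_scale mulrA -rmorphM -polyCM. Qed.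

Fact ratfun_scale1 : left_id 1 ratfun_scale.
Proof. by move=> f; rewrite /ratfun_scale polyC1 rmorph1 mul1r. Qed.

Fact ratfun_scaleDr : right_distributive ratfun_scale +%R.
Proof. by move=> c f g; rewrite /ratfun_scale mulrDr. Qed.

Fact ratfun_scaleDl f : {morph ratfun_scale^~ f : c d / c + d}.
Proof. by move=> c d; rewrite /ratfun_scale polyCD rmorphD mulrDl. Qed.

HB.instance Definition _ := GRing.Zmodule_isLmodule.Build K ratfun
  ratfun_scaleA ratfun_scale1 ratfun_scaleDr ratfun_scaleDl.

Fact ratfun_scaleE c f : c *: f = ratfun_poly c%:P * f.
Proof. by []. Qed.

Fact ratfun_scaleAl c f g : c *: (f * g) = c *: f * g.
Proof. exact: mulrA. Qed.

HB.instance Definition _ := GRing.Lmodule_isLalgebra.Build K ratfun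
  ratfun_scaleAl.

Fact ratfun_scaleAr c f g : c *: (f * g) = f * (c *: g).
Proof. exact: mulrCA. Qed.

HB.instance Definition _ := GRing.Lalgebra_isAlgebra.Build K ratfun
  ratfun_scaleAr.

(* d/dalpha: the quotient rule applied to a representative p / q;
   [ratderiv_frac] shows that the choice of p and q is irrelevant. *)
Definition ratderiv f : ratfun :=
  let p := \n_(repr f) in let q := \d_(repr f) in
  ratfun_poly (p^`() * q - p * q^`()) / ratfun_poly (q ^+ 2).

Fact ratfun_poly_inj : injective ratfun_poly.
Proof. by move=> p q /eqP; rewrite tofrac_eq => /eqP. Qed.

Fact ratfun_poly_eq0 p : (ratfun_poly p == 0) = (p == 0).
Proof. exact: tofrac_eq0. Qed.

Fact ratfun_repr f : f = ratfun_poly \n_(repr f) / ratfun_poly \d_(repr f).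
Proof.
have d0 : ratfun_poly \d_(repr f) != 0 by rewrite ratfun_poly_eq0 denom_ratioP.
apply: (mulIf d0); rewrite divfK //.
rewrite -{1}[f]reprK /ratfun_poly; unlock FracField.tofrac.
rewrite [LHS](_ : _ = FracField.mul (\pi_(FracField.type {poly K})%qT (repr f))
  (\pi_(FracField.type {poly K})%qT (Ratio \d_(repr f) 1))) //.
rewrite -FracField.pi_mul; apply/eqmodP => /=; rewrite FracField.equivfE.
rewrite /FracField.mulf !numden_Ratio ?(oner_neq0, mulr1, denom_ratioP) //.
by rewrite mulrC.
Qed.

Lemma ratderiv_frac p q : q != 0 ->
  ratderiv (ratfun_poly p / ratfun_poly q) =
  ratfun_poly (p^`() * q - p * q^`()) / ratfun_poly (q ^+ 2).
Proof.
move=> q0; rewrite /ratderiv.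
have := ratfun_repr (ratfun_poly p / ratfun_poly q).
have := denom_ratioP (repr (ratfun_poly p / ratfun_poly q)).
move: (\n_(repr _)) (\d_(repr _)) => n d /= d0.
have qF : ratfun_poly q != 0 by rewrite ratfun_poly_eq0.
have dF : ratfun_poly d != 0 by rewrite ratfun_poly_eq0.
move/eqP; rewrite (eqr_div _ _ qF dF) -!ratfun_polyM => /eqP/ratfun_poly_inj E.
have q2F : ratfun_poly (q ^+ 2) != 0 by rewrite ratfun_poly_eq0 expf_neq0.
have d2F : ratfun_poly (d ^+ 2) != 0 by rewrite ratfun_poly_eq0 expf_neq0.
apply/eqP; rewrite (eqr_div _ _ d2F q2F) -!ratfun_polyM.
apply/eqP; congr ratfun_poly.
have E' : p^`() * d + p * d^`() = n^`() * q + n * q^`().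
  by rewrite -!derivM E.
have -> : (n^`() * d - n * d^`()) * q ^+ 2 =
  (n^`() * q + n * q^`()) * d * q - n * q * (d^`() * q + d * q^`()) by ring.
have -> : (p^`() * q - p * q^`()) * d ^+ 2 =
  (p^`() * d + p * d^`()) * d * q - p * d * (d^`() * q + d * q^`()) by ring.
by rewrite E E'.
Qed.

Fact ratderiv_is_linear : linear ratderiv.
Proof.
move=> c f g; rewrite (ratfun_repr f) (ratfun_repr g).
have := denom_ratioP (repr f); have := denom_ratioP (repr g).
move: (\n_(repr f)) (\d_(repr f)) (\n_(repr g)) (\d_(repr g)) => a b u v /=.
move=> v0 b0.
have vF : ratfun_poly v != 0 by rewrite ratfun_poly_eq0.
have bF : ratfun_poly b != 0 by rewrite ratfun_poly_eq0.
have -> : c *: (ratfun_poly a / ratfun_poly b) + ratfun_poly u / ratfun_poly v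
    = ratfun_poly (c%:P * a * v + u * b) / ratfun_poly (b * v).
  rewrite ratfun_scaleE mulrA -ratfun_polyM (addf_div _ _ bF vF).
  by rewrite -!ratfun_polyM -ratfun_polyD.
rewrite ratderiv_frac ?mulf_neq0 // (ratderiv_frac _ v0) (ratderiv_frac _ b0).
rewrite ratfun_scaleE mulrA.
have v2F : ratfun_poly (v ^+ 2) != 0 by rewrite ratfun_poly_eq0 expf_neq0.
have b2F : ratfun_poly (b ^+ 2) != 0 by rewrite ratfun_poly_eq0 expf_neq0.
rewrite -ratfun_polyM (addf_div _ _ b2F v2F) -!ratfun_polyM -ratfun_polyD exprMn; congr (ratfun_poly _ / _).
by rewrite !derivE; ring.
Qed.

HB.instance Definition _ :=
  GRing.isLinear.Build K ratfun ratfun _ ratderiv ratderiv_is_linear.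

End RationalFunctions.

(* Inverse formal Laurent series: coefficient families vanishing in all
   sufficiently large degrees. *)
Section Laurent.
Variable L : fieldType.

Definition laurent_pred : {pred int -> L} :=
  fun f => `[< exists k : int, forall i, k < i -> f i = 0 >].

Record laurent := Laurent { lcoef :> int -> L ; _ : laurent_pred lcoef }.

HB.instance Definition _ := [isSub for lcoef].
HB.instance Definition _ := [Choice of laurent by <:].

Fact laurent_zmod_closed : zmod_closed laurent_pred.
Proof.
split=> [|f g /asboolP[k fk] /asboolP[l gl]]; apply/asboolP.
  by exists 0.
exists (Num.max k l) => i; rewrite gt_max => /andP[ki li].
have -> : (f - g) i = f i - g i by [].
by rewrite fk // gl // subr0.
Qed.

HB.instance Definition _ :=
  GRing.isZmodClosed.Build (int -> L) laurent_pred laurent_zmod_closed.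
HB.instance Definition _ := [SubChoice_isSubZmodule of laurent by <:].

Implicit Types f g h : laurent.

Fact laurentP f g : (forall i, f i = g i) -> f = g.
Proof. by move=> fg; apply: val_inj; apply/funext. Qed.

Fact laurent_bound f : exists k : int, forall i, k < i -> f i = 0.
Proof. by case: f => f /= /asboolP. Qed.

Fact lcoefD f g i : (f + g) i = f i + g i.
Proof. by []. Qed.

Fact lcoefN f i : (- f) i = - f i.
Proof. by []. Qed.

Fact lcoef0 i : (0 : laurent) i = 0.
Proof. by []. Qed.

Fact lscale_subproof (b : L) f : laurent_pred (fun i => b * f i).
Proof.
have [k fk] := laurent_bound f; apply/asboolP; exists k => i /fk ->.
exact: mulr0.
Qed.

Definition lscale (b : L) f : laurent := Laurent (lscale_subproof b f).

Fact lscaleA a b f : lscale a (lscale b f) = lscale (a * b) f.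
Proof. by apply: laurentP => i /=; rewrite mulrA. Qed.

Fact lscale1 : left_id 1 lscale.
Proof. by move=> f; apply: laurentP => i /=; rewrite mul1r. Qed.

Fact lscaleDr : right_distributive lscale +%R.
Proof. by move=> a f g; apply: laurentP => i; exact: mulrDr. Qed.

Fact lscaleDl f : {morph lscale^~ f : a b / a + b}.
Proof. by move=> a b; apply: laurentP => i; exact: mulrDl. Qed.

HB.instance Definition _ := GRing.Zmodule_isLmodule.Build L laurent
  lscaleA lscale1 lscaleDr lscaleDl.

Fact lmono_subproof (a : L) (i : int) :
  laurent_pred (fun j => if j == i then a else 0).
Proof. by apply/asboolP; exists i => j; case: eqP => // ->; rewrite ltxx. Qed.

(* The monomial a T^i; in particular b in L is [lmono b 0] and T^i is
   [lmono 1 i]. *)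
Definition lmono (a : L) (i : int) : laurent := Laurent (lmono_subproof a i).

(* The standard degree map, with values in Z extended by -oo (and +oo, which
   is never taken). *)
Definition ldeg f : \bar int :=
  xget -oo%E [set k%:E%E | k in [set k : int |
    f k != 0 /\ forall i, k < i -> f i = 0]].

Fact ldeg_lead f (k : int) :
  f k != 0 -> (forall i, k < i -> f i = 0) -> ldeg f = k%:E%E.
Proof.
move=> fk0 fk; rewrite /ldeg.
case: xgetP => [_ -> [l [fl0 fl] <-]|/(_ k%:E%E)]; last by case; exists k.
congr (_%:E)%E; apply/eqP; rewrite eq_le !leNgt; apply/andP; split.
  by apply/negP => /fk fl_eq0; rewrite fl_eq0 eqxx in fl0.
by apply/negP => /fl fk_eq0; rewrite fk_eq0 eqxx in fk0.
Qed.

Fact ldeg0 : ldeg 0 = -oo%E.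
Proof.
by rewrite /ldeg xgetPN // => x [k [/eqP k0 _] _]; exact: k0.
Qed.

Fact laurent_lead f : f != 0 ->
  exists2 k : int, f k != 0 & forall i, k < i -> f i = 0.
Proof.
move=> f0; have [k fk] := laurent_bound f.
have [j fj] : exists j, f j != 0.
  apply/not_existsP => fz; move/eqP: f0; apply; apply: laurentP => i.
  by apply/eqP; apply/negP => fi; apply: (fz i); apply/negP.
have jk : j <= k by rewrite leNgt; apply/negP => /fk fj0; rewrite fj0 eqxx in fj.
have exn : exists n : nat, f (k - n%:Z) != 0.
  exists `|(k - j)|%N; rewrite (_ : k - _ = j) //; lia.
case: (ex_minnP exn) => n fn nmin; exists (k - n%:Z) => // i ni.
have [/fk //|ik] := ltP k i.
apply/eqP; apply/negPn/negP => fi.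
have := nmin `|(k - i)|%N; rewrite (_ : k - _ = i); last by lia.
by move=> /(_ fi); lia.
Qed.

(* e ^ deg (f - g), with e ^ -oo = 0. *)
Definition ldist f g : Rdefinitions.R :=
  fine (expeR (er_map intr (ldeg (f - g)))).

Fact ldist_lead f g (k : int) : (f - g) k != 0 ->
  (forall i, k < i -> (f - g) i = 0) -> ldist f g = expR k%:~R.
Proof. by move=> h1 h2; rewrite /ldist (ldeg_lead h1 h2). Qed.

Fact ldistxx f : ldist f f = 0.
Proof. by rewrite /ldist subrr ldeg0. Qed.

Fact ldist_gt0 f g : f != g -> 0 < ldist f g.
Proof.
rewrite -subr_eq0 => /laurent_lead[k h1 h2].
by rewrite (ldist_lead h1 h2) expR_gt0.
Qed.

Fact ldist_ge0 f g : 0 <= ldist f g.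
Proof. by have [->|/ldist_gt0/ltW//] := eqVneq f g; rewrite ldistxx. Qed.

Fact ldist_positivity f g : ldist f g = 0 -> f = g.
Proof. by move=> d0; apply/eqP/negPn/negP => /ldist_gt0; rewrite d0 ltxx. Qed.

Fact ldist_le f g (k : int) :
  (forall i, k < i -> f i = g i) -> ldist f g <= expR k%:~R.
Proof.
move=> fg; have [->|] := eqVneq f g; first by rewrite ldistxx expR_ge0.
rewrite -subr_eq0 => /laurent_lead[l h1 h2].
rewrite (ldist_lead h1 h2) ler_expR ler_int leNgt; apply/negP => /fg fgl.
by move: h1; rewrite lcoefD lcoefN fgl subrr eqxx.
Qed.

Fact ldist_sym f g : ldist f g = ldist g f.
Proof.
have [->//|] := eqVneq f g; rewrite -subr_eq0 => /laurent_lead[l h1 h2].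
rewrite (ldist_lead h1 h2); apply/esym/ldist_lead => [|i /h2 hi];
  rewrite -opprB lcoefN ?oppr_eq0 //.
by rewrite hi oppr0.
Qed.

Fact ldist_triangle g f h : ldist f h <= ldist f g + ldist g h.
Proof.
have [->|fh] := eqVneq f h; first by rewrite ldistxx addr_ge0 ?ldist_ge0.
have := fh; rewrite -subr_eq0 => /laurent_lead[k h1 h2].
rewrite (ldist_lead h1 h2).
suff : (expR k%:~R <= ldist f g) \/ (expR k%:~R <= ldist g h).
  case=> /le_trans; apply; first by rewrite lerDl ldist_ge0.
  by rewrite lerDr ldist_ge0.
have key (u v : laurent) : u k != v k -> expR k%:~R <= ldist u v.
  move=> uvk; have : u != v by apply: contraNneq uvk => ->.
  rewrite -subr_eq0 => /laurent_lead[l e1 e2].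
  rewrite (ldist_lead e1 e2) ler_expR ler_int leNgt; apply/negP => /e2.
  by move/eqP; rewrite lcoefD lcoefN subr_eq0 (negbTE uvk).
have [fgk|/key] := eqVneq (f k) (g k); last by left.
right; apply: key; rewrite -fgk -subr_eq0; exact: h1.
Qed.

HB.instance Definition _ := isMetric.Build Rdefinitions.R laurent
  ldistxx ldist_positivity ldist_sym ldist_triangle.

(* [mul] makes L((1/T)) a deformed Laurent series ring (with the standard
   degree map). *)
Record deformed_laurent_ring (mul : laurent -> laurent -> laurent) : Prop :=
  DeformedLaurentRing {
    dlr_assoc : associative mul;
    dlr_distrl : left_distributive mul +%R;
    dlr_distrr : right_distributive mul +%R;
    dlr_continuous : continuous (fun p : laurent * laurent => mul p.1 p.2);
    dlr_scalar : forall (b : L) f, mul (lmono b 0) f = b *: f;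
    dlr_powers : forall i j : int,
      mul (lmono 1 i) (lmono 1 j) = lmono 1 (i + j);
    dlr_deg : forall f g, ldeg (mul f g) = (ldeg f + ldeg g)%E
  }.

(* The family F has (unordered) sum l: its finite partial sums converge to l
   along the directed set of finite subsets of I. *)
Definition has_sum (I : choiceType) (F : I -> laurent) (l : laurent) : Prop :=
  summability.partial_sum F @ summability.totally --> l.

End Laurent.

(* For F of characteristic 0 and a the image of a rational number q, this is
   the image in F of the rational number (q choose k). *)
Definition gbinom (F : fieldType) (a : F) (k : nat) : F :=
  (\prod_(0 <= i < k) (a - i%:R)) / k`!%:R.

Section Data.
Variable K : fieldType.
Implicit Types (nu s i : int) (k : nat) (f : ratfun K).

Definition dcoef nu s k : K :=
  s%:~R ^- k * \prod_(0 <= i < k) (1 - i%:R * nu%:~R).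

(* Only used for i <= 1; it is 0 for the other i. *)
Definition delta nu s i f : ratfun K :=
  if (i <= 1) && (nu %| 1 - i)%Z then
    let k := `|((1 - i) %/ nu)%Z|%N in
    (dcoef nu s k / k`!%:R) *: iter k (@ratderiv K) f
  else 0.

Fact iter_ratderiv_is_linear k : linear (iter k (@ratderiv K)).
Proof. by elim: k => [|k IHk] c f g; rewrite ?iterS // IHk linearP. Qed.

Fact delta_is_linear nu s i : linear (delta nu s i).
Proof.
move=> c f g; rewrite /delta; case: ifP => _; last by rewrite scaler0 addr0.
by rewrite /= iter_ratderiv_is_linear scalerDr !scalerA mulrC.
Qed.

HB.instance Definition _ nu s i := GRing.isLinear.Build K (ratfun K) (ratfun K)
  _ (delta nu s i) (delta_is_linear nu s i).

Fact deltaE nu s k f : 0 < nu ->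
  delta nu s (1 - k%:Z * nu) f =
  (dcoef nu s k / k`!%:R) *: iter k (@ratderiv K) f.
Proof.
move=> nu0; rewrite /delta subKr dvdz_mull // mulzK ?gt_eqF //.
by rewrite gerBl mulr_ge0 ?(ltW nu0).
Qed.

Definition lam nu s i k : K :=
  if k == 0 then 1 else
  (nu%:~R / s%:~R) ^+ k *
  \sum_(1 <= l < k.+1)
    (-1) ^+ (k - l) * gbinom i%:~R l * gbinom (i - l%:Z - 1)%:~R (k - l)
    * gbinom (l%:R * nu%:~R^-1) k.

(* T . f = f . T + \sum_(k >= 1) delta_(1 - k nu)(f) . T^(1 - k nu) for f in L. *)
Definition commutation_rule nu s
    (mul : laurent (ratfun K) -> laurent (ratfun K) -> laurent (ratfun K)) :=
  forall f, exists2 S : laurent (ratfun K),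
    has_sum (fun k : nat =>
      mul (lmono (delta nu s (1 - k.+1%:Z * nu) f) 0)
          (lmono 1 (1 - k.+1%:Z * nu))) S
    & mul (lmono 1 1) (lmono f 0) = mul (lmono f 0) (lmono 1 1) + S.

End Data.

(* The pairs (l, [:: j_1; ...; j_k]), k > 0, of nonpositive integers with
   j_1 + ... + j_k - k + l = i. *)
Definition leibniz_index (i : int) : set (int * seq int) :=
  [set p | [/\ (0 < size p.2)%N, p.1 <= 0, {in p.2, forall j, j <= 0}
    & \sum_(j <- p.2) j - (size p.2)%:Z + p.1 = i]].

Lemma finite_leibniz_index (i : int) : finite_set (leibniz_index i).
Proof.
pose n := `|i|%N.
pose F (p : 'I_n.+1 * {bseq n of 'I_n.+1}) : int * seq int :=
  (- (p.1 : nat)%:Z, [seq - (nat_of_ord j)%:Z | j <- p.2]).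
apply: (@sub_finite_set _ _ (range F)); last exact: finite_image.
move=> [l js] [/= _ l0 js0 E].
have bound t : {in t, forall j : int, j <= 0} ->
    \sum_(j <- t) j <= 0 /\ {in t, forall j, \sum_(j <- t) j <= j}.
  elim: t => [|x t IHt] t0; first by rewrite big_nil.
  rewrite big_cons; have x0 : x <= 0 by apply: t0; rewrite mem_head.
  have [] := IHt _; first by move=> j jt; apply: t0; rewrite inE jt orbT.
  move=> S0 SJ; split=> [|j]; first by rewrite -[leRHS]addr0 lerD.
  by rewrite inE => /orP[/eqP->|/SJ Sj]; rewrite ?gerDl // -[j]add0r lerD.
have [] := bound _ js0; move: (\sum_(j <- js) j) E => S E S0 SJ.
have sz : (size js <= n)%N by rewrite /n; lia.
have sz' : (size [seq (inord `|j|%N : 'I_n.+1) | j <- js] <= n)%N.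
  by rewrite size_map.
exists (inord `|l|%N, Bseq sz') => //=; congr pair.
  by rewrite /= inordK; rewrite /n; lia.
rewrite /= -map_comp -[RHS]map_id; apply/eq_in_map => j jjs /=.
have Sj : S <= j := SJ _ jjs; have j0 : j <= 0 := js0 _ jjs.
by rewrite inordK; rewrite /n; lia.
Qed.

(* Main.v *)
(* With c = nu / s, one has d_k / k! = c^k binom(1/nu, k), so T acts on functions
   of alpha like the (1/nu)-th power of an operator U with U f = f U + c f'.  This
   suggests T^i . f = sum_k c^k binom(i/nu, k) f^(k) T^(i - k nu), where lambda_i^k
   is the Lagrange interpolation of binom(x/nu, k) at the nodes x = 0, ..., k.
   Associativity on monomials is the Leibniz rule together with Vandermonde's
   identity, and it extends to all series because additive maps shifting degrees
   by a bounded amount are determined by their values on monomials.  The same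
   principle shows that a deformed Laurent series ring is determined by the
   products T . f.  The identities for delta_i compare coefficients in
   T . (ab) = (T . a) . b, after expanding (1 + z)^(l/nu) as the l-th power of
   1 + ((1 + z)^(1/nu) - 1). *)
Require Import Defs.
From HB Require Import structures.
From mathcomp Require Import all_boot all_order all_algebra.
From mathcomp Require Import finmap.
From mathcomp Require Import all_classical all_reals.
From mathcomp Require Import topology sequences exp.
From mathcomp Require Import Rstruct Rstruct_topology.
From mathcomp Require summability.
From mathcomp Require Import ring zify.

Set Implicit Arguments.
Unset Strict Implicit.
Unset Printing Implicit Defensive.

Import Order.TTheory GRing.Theory Num.Theory.

Local Open Scope classical_set_scope.
Local Open Scope ring_scope.

(** * Generalized binomial coefficients over a field of characteristic 0 *)

Section GeneralizedBinomials.
Variable F : fieldType.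
Implicit Types (a b x : F) (k n p : nat) (l : int) (t : seq nat).

Lemma gbinom0 a : gbinom a 0 = 1.
Proof. by rewrite /gbinom big_geq // fact0 divr1. Qed.

Lemma gbinom_nat_gt n k : (n < k)%N -> gbinom (n%:R : F) k = 0.
Proof.
move=> nk; rewrite /gbinom big_mkord (bigD1 (Ordinal nk)) //=.
by rewrite subrr !mul0r.
Qed.

Lemma gbinom0l k : gbinom (0 : F) k = (k == 0)%:R.
Proof.
by case: k => [|k]; [rewrite gbinom0|rewrite -[0](mulr0n 1) gbinom_nat_gt].
Qed.

Hypothesis charF : [pchar F] =i pred0.

Lemma natf_neq0 n : (n.+1%:R : F) != 0.
Proof. by have /pcharf0P -> := charF. Qed.

Lemma factf_neq0 n : (n`!%:R : F) != 0.
Proof. by have /pcharf0P -> := charF; rewrite -lt0n fact_gt0. Qed.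

Lemma intf_neq0 l : l != 0 -> (l%:~R : F) != 0.
Proof. by case: l => [[|n]|n] // _; rewrite ?NegzE ?rmorphN ?oppr_eq0 natf_neq0. Qed.

(** Stands in for the factorial denominator: later inductions multiply by the nonzero [k.+1%:R] and
    apply this recursion. *)
Lemma gbinomS a k : k.+1%:R * gbinom a k.+1 = gbinom a k * (a - k%:R).
Proof.
have h1 := factf_neq0 k; have h2 := natf_neq0 k.
rewrite /gbinom big_nat_recr //= factS natrM.
by move: (k`!%:R) (k.+1%:R) (_ - _) h1 h2 => u v w u0 v0; field; rewrite u0 v0.
Qed.

Lemma gbinom_pascal a k : gbinom (a + 1) k.+1 = gbinom a k.+1 + gbinom a k.
Proof.
elim: k => [|k IH].
  by apply: (mulfI (natf_neq0 0)); rewrite mulrDr !gbinomS !gbinom0; ring.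
apply: (mulfI (natf_neq0 k.+1)); rewrite mulrDr !gbinomS {}IH.
have := gbinomS a k; move: (gbinom a k) (gbinom a k.+1) => u v h.
rewrite -[k.+2]addn1 -[k.+1]addn1 in h *; rewrite !natrD in h *.
have -> : (v + u) * (a + 1 - (k%:R + 1%:R)) =
  v * (a - k%:R) + u * (a - k%:R) by ring.
by rewrite -h; ring.
Qed.

Lemma gbinomN1 k : gbinom (- 1 : F) k = (- 1) ^+ k.
Proof.
elim: k => [|k IH]; first by rewrite gbinom0.
have := gbinom_pascal (- 1) k; rewrite addrC subrr gbinom0l /= exprS -IH.
by move=> /esym/eqP; rewrite addr_eq0 => /eqP ->; rewrite mulN1r.
Qed.

Lemma gbinom_nn n : gbinom (n%:R : F) n = 1.
Proof.
elim: n => [|n IH]; first by rewrite gbinom0.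
by rewrite -natr1 gbinom_pascal IH gbinom_nat_gt // add0r.
Qed.

Lemma gbinom_vandermonde a b n :
  gbinom (a + b) n = \sum_(k < n.+1) gbinom a k * gbinom b (n - k).
Proof.
elim: n => [|n IH]; first by rewrite big_ord_recl big_ord0 !gbinom0 mulr1 addr0.
apply: (mulfI (natf_neq0 n)); rewrite gbinomS IH.
(* Writing n + 1 as k + (n + 1 - k) lets [gbinomS] lower one index in each sum; the factors a - k
   and b - (n - k) then add up to a + b - n. *)
have -> : n.+1%:R * (\sum_(k < n.+2) gbinom a k * gbinom b (n.+1 - k)) =
  \sum_(k < n.+2) k%:R * gbinom a k * gbinom b (n.+1 - k) +
  \sum_(k < n.+2) gbinom a k * ((n.+1 - k)%:R * gbinom b (n.+1 - k)).
  rewrite -big_split mulr_sumr; apply: eq_bigr => k _ /=.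
  by rewrite natrB ?(ltnW (ltn_ord k)) // -1?ltnS //; ring.
rewrite [X in _ = X + _]big_ord_recl [X in _ = _ + X]big_ord_recr /= subnn !mul0r mulr0.
rewrite add0r addr0 -big_split mulr_suml; apply: eq_bigr => k _ /=.
have kn : (k <= n)%N by rewrite -ltnS.
rewrite /bump /= add1n subSS subSn // !gbinomS natrB //; ring.
Qed.

(** Trinomial revision: the product of k factors at a splits into p factors at a and k - p factors
    at a - p. *)
Lemma gbinom_trinomial a k p : (p <= k)%N ->
  gbinom a k * 'C(k, p)%:R = gbinom a p * gbinom (a - p%:R) (k - p).
Proof.
move=> pk; have h1 := factf_neq0 k; have h2 := factf_neq0 p.
have h3 := factf_neq0 (k - p).
have E : \prod_(0 <= i < k) (a - i%:R) =
  \prod_(0 <= i < p) (a - i%:R) * \prod_(0 <= i < k - p) (a - p%:R - i%:R).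
  rewrite (big_cat_nat _ pk) //=; congr (_ * _).
  rewrite -{1}[p]add0n big_addn; apply: eq_bigr => i _.
  by rewrite natrD opprD addrA addrAC.
have C : 'C(k, p)%:R = k`!%:R / (p`!%:R * (k - p)`!%:R) :> F.
  by rewrite -(bin_fact pk) !natrM mulfK // mulf_neq0.
rewrite /gbinom E C; move: (k`!%:R) (p`!%:R) ((k-p)`!%:R) h1 h2 h3.
by move=> x y z hx hy hz; field; rewrite hx hy hz.
Qed.

(** Trinomial revision pulls out [gbinom x p]; the rest is Vandermonde's identity for x - p and y.
    Associativity on monomials comes down to this sum. *)
Lemma trinomial_sum x y N p : (p <= N)%N ->
  \sum_(p <= k < N.+1) gbinom x k * 'C(k, p)%:R * gbinom y (N - k) =
  gbinom x p * gbinom (x - p%:R + y) (N - p).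
Proof.
move=> pN; rewrite gbinom_vandermonde mulr_sumr -{1}[p]add0n big_addn subSn //.
rewrite big_mkord; apply: eq_bigr => k _.
by rewrite gbinom_trinomial ?leq_addl // addnK mulrA subnDA subnAC.
Qed.

(* Both sides are polynomials in a of degree at most k that agree at 0, ..., k. *)
Lemma gbinom_lagrange a x k : (0 < k)%N ->
  \sum_(1 <= l < k.+1) (-1) ^+ (k - l) * gbinom a l
     * gbinom (a - l%:R - 1) (k - l) * gbinom (l%:R * x) k = gbinom (a * x) k.
Proof.
move=> k0.
(* [B q n] is a binomial coefficient with the polynomial q on top: its value at z is that of
   [gbinom] at q(z). *)
pose B (q : {poly F}) n : {poly F} := (\prod_(i < n) (q - i%:R%:P)) * ((n`!)%:R^-1)%:P.
have BE q n z : (B q n).[z] = gbinom q.[z] n.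
  rewrite /B hornerM hornerC horner_prod /gbinom big_mkord; congr (_ * _).
  by apply: eq_bigr => i _; rewrite hornerD hornerN hornerC.
have szM (p q : {poly F}) m n :
    (size p <= m.+1)%N -> (size q <= n.+1)%N -> (size (p * q)%R <= (m + n).+1)%N.
  move=> sp sq; apply: leq_trans (size_polyMleq _ _) _.
  by move: (size p) (size q) sp sq => u v; lia.
have szB (q : {poly F}) n : (size q <= 2)%N -> (size (B q n) <= n.+1)%N.
  move=> sq; rewrite -(addn0 n.+1) addSn; apply: (szM); last exact: size_polyC_leq1.
  elim: n => [|n IH]; first by rewrite big_ord0 size_poly1.
  rewrite big_ord_recr -(addn1 n.+1) addSn; apply: (szM) => //.
  apply: leq_trans (size_polyD _ _) _; rewrite size_polyN geq_max sq.
  by apply: leq_trans (size_polyC_leq1 _) _.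
pose Q (l : nat) := ((-1) ^+ (k - l) * gbinom (l%:R * x) k) *:
  (B 'X l * B ('X - l%:R%:P - 1) (k - l)%N).
pose P := \sum_(1 <= l < k.+1) Q l - B (x *: 'X) k.
have PE z : P.[z] = \sum_(1 <= l < k.+1) (-1) ^+ (k - l) * gbinom z l
     * gbinom (z - l%:R - 1) (k - l) * gbinom (l%:R * x) k - gbinom (z * x) k.
  rewrite /P hornerD hornerN horner_sum BE hornerZ hornerX [x * z]mulrC.
  congr (_ - _); apply: eq_bigr => l _.
  by rewrite /Q hornerZ hornerM !BE !(hornerD, hornerN, hornerX, hornerC); ring.
suff P0 : P = 0 by apply/eqP; rewrite -subr_eq0 -PE P0 horner0.
have szP : (size P <= k.+1)%N.
  apply: leq_trans (size_polyD _ _) _; rewrite size_polyN geq_max; apply/andP; split.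
    apply: leq_trans (size_sum _ _ _) _; apply/bigmax_leqP_seq => l.
    rewrite mem_index_iota => /andP[l1 lk] _.
    apply: leq_trans (size_scale_leq _ _) _; rewrite -(subnKC (n := k) (m := l)) //.
    rewrite addKn; apply: (szM); apply: (szB); first by rewrite size_polyX.
    by rewrite -addrA -opprD -polyC1 -polyCD size_XsubC.
  apply: (szB); apply: leq_trans (size_scale_leq _ _) _; by rewrite size_polyX.
have natf_inj : injective (fun n => n%:R : F).
  move=> m n /eqP; wlog mn : m n / (m <= n)%N.
    by move=> H; case: (leqP m n) => [/H//|/ltnW/H h]; rewrite eq_sym => /h.
  rewrite eq_sym -subr_eq0 -natrB //; have /pcharf0P -> := charF.
  by rewrite subn_eq0 => nm; apply/eqP; rewrite eqn_leq mn.
apply/eqP; apply/negPn/negP => P0.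
have := max_poly_roots (rs := [seq n%:R | n <- iota 0 k.+1]) P0.
rewrite size_map size_iota map_inj_uniq // iota_uniq leqNgt ltnS szP => H.
suff : false by []; apply: H => //; apply/allP => _ /mapP[j + ->].
rewrite mem_iota add0n ltnS => /= jk; rewrite rootE PE; apply/eqP.
(* At the node j, a term with l > j has [gbinom j l] = 0, and one with l < j has the natural number
   j - l - 1 < k - l on top of its second binomial. Only l = j can survive. *)
have van (l : nat) : (1 <= l < k.+1)%N -> l != j -> gbinom (j%:R : F) l
     * gbinom (j%:R - l%:R - 1 : F) (k - l) = 0.
  move=> /andP[l1 lk]; rewrite neq_ltn => /orP[lj|jl]; last first.
    by rewrite gbinom_nat_gt // mul0r.
  have -> : j%:R - l%:R - 1 = (j - l.+1)%:R :> F by rewrite natrB // -natr1; ring.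
  by rewrite (gbinom_nat_gt (n := _ - _)) ?mulr0 //; move: lj jk; lia.
(* No term of the sum belongs to the node 0, but the right-hand side vanishes there because k >
   0. *)
have [j0|j0] := posnP j.
  rewrite {}j0 in van *; rewrite mul0r gbinom0l gtn_eqF // subr0 big_nat.
  rewrite big1 // => l lk; rewrite -[X in X * _]mulrA van ?mulr0 ?mul0r //.
  by case: l lk.
rewrite (bigD1_seq j) ?mem_index_iota ?iota_uniq ?j0 //= big_nat_cond big1.
  by rewrite addr0 gbinom_nn subrr sub0r gbinomN1 mulr1 -expr2 sqrr_sign mul1r subrr.
by move=> l /andP[lk lj]; rewrite -[X in X * _]mulrA van // mulr0 mul0r.
Qed.

End GeneralizedBinomials.

(** * Compositions of a natural number: ordered sums of positive parts *)

Fixpoint compositions_rec (fuel n : nat) : seq (seq nat) :=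
  if n is 0 then [:: [::]] else
  if fuel is fuel'.+1 then
    [seq m :: t | m <- iota 1 n, t <- compositions_rec fuel' (n - m)]
  else [::].

(** Each part is at least 1, so n units of fuel suffice to list every composition of n. *)
Definition compositions n := compositions_rec n n.

Lemma compositions_recS fuel n : compositions_rec fuel.+1 n.+1 =
  [seq m :: t | m <- iota 1 n.+1, t <- compositions_rec fuel (n.+1 - m)].
Proof. by []. Qed.

Lemma compositions_recE fuel n : (n <= fuel)%N ->
  compositions_rec fuel n = compositions n.
Proof.
rewrite /compositions; elim/ltn_ind: n fuel => -[|n] IH [|fuel] // nf.
suff E k : (n <= k)%N -> compositions_rec k.+1 n.+1 =
    [seq m :: t | m <- iota 1 n.+1, t <- compositions (n.+1 - m)] by rewrite !E.
move=> nk; rewrite compositions_recS; apply: (congr1 flatten); apply/eq_in_map => m.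
by rewrite mem_iota => /andP[m1 mn]; rewrite /compositions (IH _ _ k) //; lia.
Qed.

Lemma compositionsS n : compositions n.+1 =
  [seq m :: t | m <- iota 1 n.+1, t <- compositions (n.+1 - m)].
Proof.
rewrite /compositions compositions_recS; apply: (congr1 flatten); apply/eq_in_map => m.
by rewrite mem_iota => /andP[m1 mn]; rewrite compositions_recE //; lia.
Qed.

Lemma mem_compositions n t :
  (t \in compositions n) = (sumn t == n) && all (leq 1) t.
Proof.
elim/ltn_ind: n t => -[|n] IH t.
  rewrite inE; case: t => [|[|m] t] //=; by rewrite andbF.
rewrite compositionsS; apply/allpairsPdep/idP => [[m [u [+ + ->]]]|].
  rewrite mem_iota => /andP[m1 mn]; rewrite IH ?subn_lt0 //=; last by lia.
  by move=> /andP[/eqP su ->]; rewrite m1 su; rewrite andbT; apply/eqP; lia.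
case: t => [|m t] // /andP[/eqP/= E /andP[m1 pt]]; exists m, t.
have mn : (m <= n.+1)%N by rewrite -E leq_addr.
split=> //; first by rewrite (mem_iota 1 n.+1) m1 add1n ltnS.
by rewrite IH; [rewrite pt andbT; apply/eqP|]; lia.
Qed.

Lemma compositions_uniq n : uniq (compositions n).
Proof.
elim/ltn_ind: n => -[|n] IH //; rewrite compositionsS.
apply: allpairs_uniq_dep => [|m|]; first exact: iota_uniq.
  by rewrite mem_iota => /andP[m1 mn]; apply: IH; lia.
by move=> [m t] [m' t'] _ _ /= [-> ->].
Qed.

Lemma big_compositionsS (V : nmodType) n (G : seq nat -> V) :
  \sum_(t <- compositions n.+1) G t =
  \sum_(1 <= m < n.+2) \sum_(t <- compositions (n.+1 - m)) G (m :: t).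
Proof. by rewrite compositionsS big_allpairs_dep /= /index_iota subn1. Qed.

(* The coefficients of ((1 + z)^x)^l, with (1 + z)^x expanded as 1 + (terms of
   positive degree). *)
Lemma gbinom_compositions (F : fieldType) (charF : [pchar F] =i pred0)
    (x : F) (l : int) n :
  \sum_(t <- compositions n)
    gbinom (l%:~R : F) (size t) * \prod_(m <- t) gbinom x m =
  gbinom (l%:~R * x) n.
Proof.
elim/ltn_ind: n l => -[|n] IH l.
  by rewrite big_seq1 !gbinom0 big_nil mulr1.
pose A (l : int) := \sum_(t <- compositions n.+1)
    gbinom (l%:~R : F) (size t) * \prod_(m <- t) gbinom x m.
(* In the difference over j, Pascal's rule lowers the length by one, which cuts off the first part
   m; by induction on n this gives Vandermonde's sum for x + j x without its term of index 0. *)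
have step (j : int) : A (j + 1) - A j =
    gbinom ((j + 1)%:~R * x) n.+1 - gbinom (j%:~R * x) n.+1.
  have -> : (j + 1)%:~R * x = x + j%:~R * x by rewrite rmorphD mulrDl mul1r addrC.
  rewrite gbinom_vandermonde // big_ord_recl /= gbinom0 mul1r subn0.
  rewrite [RHS]addrAC subrr add0r.
  rewrite /A !big_compositionsS -sumrB.
  rewrite -(big_mkord xpredT (fun i => gbinom x (bump 0 i) * gbinom (j%:~R
    * x) (n.+1 - bump 0 i))).
  rewrite [RHS](_ : _ = \sum_(1 <= m < n.+2) gbinom x m * gbinom (j%:~R * x)
    (n.+1 - m)); last first.
    by rewrite big_add1.
  apply: eq_big_nat => m /andP[m1 mn].
  rewrite -IH; last by lia.
  rewrite -sumrB mulr_sumr; apply: eq_bigr => t _ /=.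
  by rewrite rmorphD /= gbinom_pascal // big_cons; ring.
have A0 : A 0 = gbinom (0%:~R * x) n.+1.
  rewrite mul0r gbinom0l /A big_seq big1 // => t; rewrite mem_compositions.
  by case: t => [|m t] //= _; rewrite gbinom0l mul0r.
rewrite -/(A l); elim/int_rect: l => // [m|m] IHm.
  have := step m; rewrite (_ : m%:Z + 1 = m.+1%:Z); last by lia.
  by rewrite IHm => /addIr.
have := step (- m.+1%:Z); rewrite (_ : - m.+1%:Z + 1 = - m%:Z); last by lia.
by rewrite IHm => /addrI/oppr_inj.
Qed.

(** * The degree filtration on Laurent series, convergence, and additive maps *)

Section DegreeFiltration.
Variable L : fieldType.
Implicit Types (f g h x : laurent L) (i j k m n : int) (a b : L).

Definition below k f := forall i, k < i -> f i = 0.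

Lemma below_le k m f : k <= m -> below k f -> below m f.
Proof. by move=> km fk i mi; apply: fk; apply: le_lt_trans mi. Qed.

Lemma belowD k f g : below k f -> below k g -> below k (f + g).
Proof. by move=> fk gk i ki; rewrite lcoefD fk // gk // addr0. Qed.

Lemma belowN k f : below k f -> below k (- f).
Proof. by move=> fk i ki; rewrite lcoefN fk // oppr0. Qed.

Lemma belowB k f g : below k f -> below k g -> below k (f - g).
Proof. by move=> fk gk; apply: belowD => //; apply: belowN. Qed.

Lemma below_sum k (I : Type) (r : seq I) (P : pred I) (F : I -> laurent L) :
  (forall j : I, P j -> below k (F j)) -> below k (\sum_(i <- r | P i) F i).
Proof. by move=> Fk; elim/big_ind: _ => //; exact: belowD. Qed.

Lemma below_lmono a i : below i (lmono a i).
Proof. by move=> j ij /=; rewrite gt_eqF. Qed.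

(** The filtration is separated: two series are equal once their difference is below every
    degree. *)
Lemma below_eq0 f : (forall k, below k f) -> f = 0.
Proof. by move=> fk; apply: laurentP => i; apply: (fk (i - 1)); rewrite gtrBl. Qed.

Lemma lcoef_sum (I : Type) (r : seq I) (P : pred I) (F : I -> laurent L) i :
  (\sum_(j <- r | P j) F j) i = \sum_(j <- r | P j) F j i.
Proof. exact: (big_morph (fun f => f i) (fun f g => lcoefD f g i) (lcoef0 L i)). Qed.

Lemma lmono0 i : lmono 0 i = 0 :> laurent L.
Proof. by apply: laurentP => j /=; case: ifP. Qed.

Lemma scale_lmono a b i : a *: lmono b i = lmono (a * b) i :> laurent L.
Proof. by apply: laurentP => j /=; case: ifP; rewrite ?mulr0. Qed.

Lemma ldeg_below f k : (ldeg f <= k%:E)%E -> below k f.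
Proof.
have [->//|/laurent_lead[l fl fl0]] := eqVneq f 0.
by rewrite (ldeg_lead fl fl0) lee_fin => lk; apply: below_le fl0.
Qed.

Lemma below_ldeg f k : below k f -> (ldeg f <= k%:E)%E.
Proof.
have [->|/laurent_lead[l fl fl0]] := eqVneq f 0; first by rewrite ldeg0 leNye.
move=> fk; rewrite (ldeg_lead fl fl0) lee_fin leNgt; apply/negP => /fk.
by move/eqP; rewrite (negbTE fl).
Qed.

(** Nonzero distances are integral powers of [expR 1], so the topology can be handled through
    degrees of differences alone. *)
Lemma nbhs_laurentP f (U : set (laurent L)) :
  nbhs f U <-> exists k, forall g, below k (f - g) -> U g.
Proof.
split.
  move=> /nbhs_ballP[e /= e0 eU].
  (* Subtracting 1 makes the exponent strictly smaller than the logarithm of the radius. *)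
  exists (Num.floor (ln e) - 1) => g gk; apply: eU; rewrite ballEmdist /=.
  apply: le_lt_trans (_ : expR (Num.floor (ln e) - 1)%:~R < e).
    apply: ldist_le => i ki; apply/eqP; rewrite -subr_eq0; apply/eqP.
    exact: (gk i ki).
  rewrite -[ltRHS]lnK ?posrE // ltr_expR.
  by apply: lt_le_trans (real_floor_le (num_real _)); rewrite ltr_int gtrBl.
(* Degrees are integers, so a distance smaller than [expR (k + 1)] is at most [expR k]. *)
move=> [k kU]; apply/nbhs_ballP; exists (expR (k + 1)%:~R); first exact: expR_gt0.
move=> g; rewrite ballEmdist /= => fg; apply: kU.
have [<-|] := eqVneq f g; first by rewrite subrr.
rewrite -subr_eq0 => /laurent_lead[l h1 h2]; apply: (below_le _ h2).
move: fg; rewrite [X in X < _](_ : _ = ldist f g) // (ldist_lead h1 h2).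
by rewrite ltr_expR ltr_int ltzD1.
Qed.

(** Replaces a series by a finite sum of monomials up to an error below m, so that additive maps can
    be evaluated on it. *)
Lemma below_trunc f k m : below k f -> exists2 r : seq int,
  uniq r /\ {in r, forall i, i <= k} &
  (forall i, m < i -> i <= k -> i \in r) /\
  below m (f - \sum_(i <- r) lmono (f i) i).
Proof.
move=> fk; pose r := [seq k - u%:Z | u <- iota 0 `|k - m|%N].
have rP i : m < i -> (i \in r) = (i <= k).
  move=> mi; apply/mapP/idP => [[u _ ->]|ik]; first by rewrite gerBl.
  by exists `|k - i|%N; rewrite ?mem_iota; lia.
have ur : uniq r by rewrite map_inj_uniq ?iota_uniq // => u v; lia.
exists r; first by split=> // _ /mapP[u _ ->]; rewrite gerBl.
split=> [i mi ik|i mi]; first by rewrite rP.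
rewrite lcoefD lcoefN lcoef_sum.
have [ir|ir] := boolP (i \in r).
  rewrite (bigD1_seq i) //= eqxx big1 ?addr0 ?subrr // => j ji.
  by rewrite eq_sym (negbTE ji).
rewrite big_seq big1 => [|j jr /=]; last by case: eqP => // ij; rewrite ij jr in ir.
by rewrite subr0 fk // ltNge -rP.
Qed.

(** The shift [e] is the same for all series: for additive maps this is a uniform form of
    continuity. *)
Definition filtered (phi : laurent L -> laurent L) :=
  exists e, forall k f, below k f -> below (k + e) (phi f).

Lemma filtered_comp phi psi : filtered phi -> filtered psi ->
  filtered (fun f => phi (psi f)).
Proof.
move=> [d phid] [e psie]; exists (e + d) => k f /psie/phid; by rewrite addrA.
Qed.

(** Additivity gives agreement on finite truncations, and the images of the tails can be pushed
    below any degree. *)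
Lemma filtered_ext phi psi :
  {morph phi : f g / f + g} -> {morph psi : f g / f + g} ->
  filtered phi -> filtered psi ->
  (forall a i, phi (lmono a i) = psi (lmono a i)) -> phi =1 psi.
Proof.
have add0 (chi : laurent L -> laurent L) : {morph chi : f g / f + g} -> chi 0 = 0.
  by move=> chiD; apply: (addrI (chi 0)); rewrite -chiD !addr0.
move=> phiD psiD [d phid] [e psie] eqm f; apply/eqP; rewrite -subr_eq0; apply/eqP.
apply: below_eq0 => k; have [b fb] := laurent_bound f.
(* The cut is low enough for both shifts d and e to bring the tail below k. *)
have [r _ [_]] := below_trunc (Num.min (k - d) (k - e)) fb.
set f0 := \sum_(i <- r) _; set m := Num.min _ _ => fm.
have -> : phi f - psi f = phi (f - f0) - psi (f - f0).
  have E : phi f0 = psi f0.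
    rewrite (big_morph _ phiD (add0 _ phiD)) (big_morph _ psiD (add0 _ psiD)).
    by apply: eq_bigr => i _; rewrite eqm.
  have := phiD (f - f0) f0; have := psiD (f - f0) f0; rewrite subrK E => -> ->.
  by rewrite opprD addrACA subrr addr0.
apply: belowB.
  by apply: below_le (phid _ _ fm); rewrite -lerBrDr ge_min lexx.
by apply: below_le (psie _ _ fm); rewrite -lerBrDr ge_min lexx orbT.
Qed.

Lemma has_sumP (I : choiceType) (F : I -> laurent L) f : has_sum F f <->
  forall k, exists A : {fset I}, forall B : {fset I}, (A `<=` B)%fset ->
    below k (f - \sum_(i <- B) F i).
Proof.
split=> [Ff k|Ff U /nbhs_laurentP[k kU]].
  have /Ff[A _ AU] : nbhs f [set g | below k (f - g)] by apply/nbhs_laurentP; exists k.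
  by exists A => B AB; rewrite big_seq_fsetE; apply: AU.
have [A AB] := Ff k; exists A => // B /AB; rewrite big_seq_fsetE; exact: kU.
Qed.

Lemma has_sum_unique (I : choiceType) (F : I -> laurent L) f g :
  has_sum F f -> has_sum F g -> f = g.
Proof.
move=> /has_sumP Ff /has_sumP Fg; apply/eqP; rewrite -subr_eq0; apply/eqP.
apply: below_eq0 => k; have [A HA] := Ff k; have [B HB] := Fg k.
have fA := HA _ (fsubsetUl A B); have gB := HB _ (fsubsetUr A B).
by have := belowB fA gB; rewrite opprB addrA subrK.
Qed.

(** By the ultrametric inequality, enlarging a good partial sum by terms below k leaves the error
    below k. *)
Lemma has_sum_below (I : choiceType) (F : I -> laurent L) f :
  (forall k, exists2 r : seq I, uniq r & (forall j : I, j \notin r -> below k (F j))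
     /\ below k (f - \sum_(i <- r) F i)) -> has_sum F f.
Proof.
move=> H; apply/has_sumP => k; have [r ur [rF rf]] := H k.
exists [fset i | i in r]%fset => B rB.
have -> : f - \sum_(i <- B) F i = f - \sum_(i <- r) F i - \sum_(i <- B | i \notin r) F i.
  rewrite (bigID (mem r)) /= opprD addrA; congr (f - _ - _).
  rewrite -big_filter; apply: perm_big; apply: uniq_perm; rewrite ?filter_uniq //.
  move=> i; rewrite mem_filter andb_idr // => ir.
  by apply: (fsubsetP rB); rewrite !inE.
by apply: belowB => //; apply: below_sum => i; exact: rF.
Qed.

End DegreeFiltration.

(** * The Leibniz rule for iterates of a derivation *)

Section Leibniz.
Variables (L : comNzRingType) (D : {additive L -> L}).
Hypothesis DM : forall x y, D (x * y) = D x * y + x * D y.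

Lemma iterD_is_additive k : {morph iter k D : x y / x + y}.
Proof. by elim: k => // k IH x y; rewrite !iterS IH raddfD. Qed.

Lemma iterD0 k : iter k D 0 = 0.
Proof. by elim: k => // k IH; rewrite iterS IH raddf0. Qed.

Lemma iterD_leibniz k x y : iter k D (x * y) =
  \sum_(p < k.+1) 'C(k, p)%:R * (iter p D x * iter (k - p) D y).
Proof.
elim: k => [|k IH]; first by rewrite big_ord1 mul1r.
pose T p q := iter p D x * iter q D y.
have DT n p q : D (n%:R * T p q) = n%:R * T p.+1 q + n%:R * T p q.+1.
  by rewrite mulr_natl raddfMn DM !mulr_natl mulrnDl.
rewrite iterS {}IH raddf_sum; under eq_bigr => p _ do rewrite DT.
rewrite big_split /=.
rewrite -(big_mkord xpredT (fun p => 'C(k, p)%:R * T p.+1 (k - p)%N)).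
rewrite -(big_mkord xpredT (fun p => 'C(k.+1, p)%:R * T p (k.+1 - p)%N)).
rewrite [RHS]big_nat_recl //.
under [in RHS]eq_bigr => p _ do rewrite binS natrD mulrDl subSS.
rewrite big_split /= addrA [RHS]addrC; congr (_ + _).
transitivity (\sum_(0 <= p < k.+2) 'C(k, p)%:R * T p (k.+1 - p)%N); last first.
  by rewrite [LHS]big_nat_recl // !bin0.
rewrite [RHS]big_nat_recr //= bin_small // mul0r addr0.
by rewrite !big_mkord; apply: eq_bigr => p _; rewrite subSn // -ltnS.
Qed.

End Leibniz.

(** * Series supported on a progression m, m - nu, m - 2 nu, and so on *)

Section ArithmeticSeries.
Variables (L : fieldType) (nu : int).
Hypothesis nu_gt0 : 0 < nu.
Implicit Types (u v : nat -> L) (f : laurent L) (i j m n : int) (k p : nat).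

Lemma mulz_inj k p : k%:Z * nu = p%:Z * nu -> k = p.
Proof. by move/(mulIf (lt0r_neq0 nu_gt0)) => -[]. Qed.

(** As [nu] is at least 1, a bound on the degree drop k nu leaves finitely many k; the finiteness of
    the sums in the product rests on this. *)
Lemma natz_le_mul k : k%:Z <= k%:Z * nu.
Proof. by nia. Qed.

(** The coefficient of T^j in the sum of [u k] T^(m - k nu) over k >= 0. *)
Definition arith_coef u m j : L :=
  if (j <= m) && (nu %| m - j)%Z then u `|((m - j) %/ nu)%Z|%N else 0.

Fact arith_subproof u m : laurent_pred (arith_coef u m).
Proof. by apply/asboolP; exists m => j mj; rewrite /arith_coef leNgt mj. Qed.

Definition arith_series u m : laurent L := Laurent (arith_subproof u m).

Lemma arith_seriesE u m k : arith_series u m (m - k%:Z * nu) = u k.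
Proof.
rewrite /= /arith_coef subKr dvdz_mull // mulzK ?gt_eqF //.
by rewrite gerBl mulr_ge0 ?(ltW nu_gt0).
Qed.

Lemma arith_series_out u m j :
  (forall k, j <> m - k%:Z * nu) -> arith_series u m j = 0.
Proof.
rewrite /= /arith_coef => mj; case: ifP => // /andP[jm /dvdzP[q qE]].
case: (mj `|q|%N); have q0 : 0 <= q by rewrite -(pmulr_lge0 _ nu_gt0) -qE subr_ge0.
by rewrite gez0_abs // -qE subKr.
Qed.

Lemma arith_seriesP u m f :
  (forall k, f (m - k%:Z * nu) = u k) ->
  (forall j, (forall k, j <> m - k%:Z * nu) -> f j = 0) -> f = arith_series u m.
Proof.
move=> fu f0; apply: laurentP => j.
have [[k ->]|/forallNP jm] := pselect (exists k, j = m - k%:Z * nu).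
  by rewrite arith_seriesE.
by rewrite f0 // arith_series_out.
Qed.

Lemma eq_arith_series u v m : u =1 v -> arith_series u m = arith_series v m.
Proof. by move=> /funext ->. Qed.

Lemma arith_series_lmono u m :
  (forall k, (0 < k)%N -> u k = 0) -> arith_series u m = lmono (u 0%N) m.
Proof.
move=> u0; apply/esym/arith_seriesP => [[|k]|j jm] /=.
- by rewrite mul0r subr0 eqxx.
- by rewrite (u0 k.+1) //; case: eqP => // E; have := natz_le_mul k.+1; lia.
- by case: eqP (jm 0%N) => // ->; rewrite mul0r subr0.
Qed.

Lemma has_sum_arith_series u m :
  has_sum (fun k : nat => lmono (u k) (m - k%:Z * nu)) (arith_series u m).
Proof.
apply: has_sum_below => n; exists (iota 0 `|m - n|%N); first exact: iota_uniq.
have out k : n < m - k%:Z * nu -> k \in iota 0 `|m - n|%N.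
  by rewrite mem_iota => h; have := natz_le_mul k; lia.
split=> [k kN|j nj].
  apply: (@below_le _ (m - k%:Z * nu)); last exact: below_lmono.
  by rewrite leNgt; apply: contraNN kN; exact: out.
rewrite lcoefD lcoefN lcoef_sum.
have [[k E]|/forallNP jm] := pselect (exists k, j = m - k%:Z * nu); last first.
  rewrite arith_series_out // sub0r big1 ?oppr0 // => k _ /=.
  by case: eqP (jm k).
rewrite {}E in nj *; rewrite arith_seriesE (bigD1_seq k) ?iota_uniq ?out //= eqxx.
rewrite big1 ?addr0 ?subrr // => p pk; case: eqP => // /addrI/oppr_inj/mulz_inj kp.
by rewrite kp eqxx in pk.
Qed.

End ArithmeticSeries.

(** * The product a T^i . b T^j = sum over k of w(i, k) a D^k(b) T^(i + j - k nu) *)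

Section TwistedMultiplication.
Variables (L : fieldType) (D : {additive L -> L}) (nu : int).
Variable w : int -> nat -> L.
Implicit Types (f g h x : laurent L) (i j m n : int) (k p N : nat) (a b e : L).
Hypothesis nu_gt0 : 0 < nu.

(* The coefficient of T^n is the sum of the contributions of
   (f_i T^i) . (g_j T^j), with n = i + j - k nu, in which g_j is derived k times. *)
Definition twist_term f g n (p : int * nat) : L :=
  w p.1 p.2 * f p.1 * iter p.2 D (g (n - p.1 + p.2%:Z * nu)).

(** A sum with infinite support would be 0 by convention; [twist_window] shows that the support is
    finite. *)
Definition twist_coef f g n : L := \sum_(p \in [set: int * nat]) twist_term f g n p.

Lemma twist_coefE f g n (r : seq (int * nat)) : uniq r ->
  (forall p : int * nat, p \notin r -> twist_term f g n p = 0) ->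
  twist_coef f g n = \sum_(p <- r) twist_term f g n p.
Proof.
move=> ur r0; rewrite /twist_coef (fsbigE r) //; last by move=> p _ /r0.
by apply: eq_bigl => p; rewrite in_setT.
Qed.

Lemma twist_term0 f g n i k (m l : int) : below m f -> below l g ->
  m < i \/ l < n - i + k%:Z * nu -> twist_term f g n (i, k) = 0.
Proof.
by move=> fm gl [/fm|/gl] /= E; rewrite /twist_term /= E ?iterD0 ?(mulr0, mul0r).
Qed.

(** One list serves all f and g with the same degree bounds, so coefficients of different products
    can be compared term by term. *)
Lemma twist_window n m (l : int) : exists2 r : seq (int * nat), uniq r &
  forall f g, below m f -> below l g ->
    forall p : int * nat, p \notin r -> twist_term f g n p = 0.
Proof.
(* A nonzero term satisfies (m - i) + k nu <= m + l - n with m - i >= 0, which bounds both m - i and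
   k. *)
pose N := `|(m + l - n)%R|%N.+1.
exists [seq (m - u%:Z, k) | u <- iota 0 N, k <- iota 0 N].
  by apply: allpairs_uniq; rewrite ?iota_uniq // => -[u k] [v p] _ _ /= [] *;
    congr (_, _); lia.
move=> f g fm gl [i k] ikr; apply: (twist_term0 fm gl); apply/orP.
rewrite !ltNge -negb_and; apply: contraNN ikr => /andP[im kl].
apply/allpairsP; exists (`|m - i|%N, k).
have kk := natz_le_mul nu_gt0 k; rewrite !mem_iota /=.
by split; [| |congr (_, _)]; lia.
Qed.

Lemma twist_coef_gt f g n m (l : int) : below m f -> below l g -> m + l < n ->
  twist_coef f g n = 0.
Proof.
move=> fm gl mln; rewrite (twist_coefE (r := [::])) ?big_nil // => -[i k] _.
apply: (twist_term0 fm gl); have := natz_le_mul nu_gt0 k; lia.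
Qed.

Fact twist_mul_subproof f g : laurent_pred (twist_coef f g).
Proof.
have [m fm] := laurent_bound f; have [l gl] := laurent_bound g.
by apply/asboolP; exists (m + l) => n; exact: twist_coef_gt.
Qed.

Definition twist_mul f g : laurent L := Laurent (twist_mul_subproof f g).

Lemma twist_mul_below f g m (l : int) :
  below m f -> below l g -> below (m + l) (twist_mul f g).
Proof. by move=> fm gl n; exact: twist_coef_gt. Qed.

Lemma twist_mulDl : left_distributive twist_mul +%R.
Proof.
move=> f g h; apply: laurentP => n; rewrite lcoefD /=.
have [m1 fm] := laurent_bound f; have [m2 gm] := laurent_bound g.
have [l hl] := laurent_bound h; pose m := Num.max m1 m2.
have {}fm : below m f by apply: below_le fm; rewrite le_max lexx.
have {}gm : below m g by apply: below_le gm; rewrite le_max lexx orbT.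
have [r ur rP] := twist_window n m l.
rewrite !(twist_coefE ur) -?big_split; try by apply: rP => //; exact: belowD.
by apply: eq_bigr => p _; rewrite /twist_term lcoefD mulrDr mulrDl.
Qed.

Lemma twist_mulDr : right_distributive twist_mul +%R.
Proof.
move=> h f g; apply: laurentP => n; rewrite lcoefD /=.
have [m1 fm] := laurent_bound f; have [m2 gm] := laurent_bound g.
have [l hl] := laurent_bound h; pose m := Num.max m1 m2.
have {}fm : below m f by apply: below_le fm; rewrite le_max lexx.
have {}gm : below m g by apply: below_le gm; rewrite le_max lexx orbT.
have [r ur rP] := twist_window n l m.
rewrite !(twist_coefE ur) -?big_split; try by apply: rP => //; exact: belowD.
by apply: eq_bigr => p _; rewrite /twist_term lcoefD iterD_is_additive mulrDr.
Qed.

Lemma twist_mul0l g : twist_mul 0 g = 0.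
Proof. by apply: (addrI (twist_mul 0 g)); rewrite -twist_mulDl !addr0. Qed.

Lemma twist_mul0r f : twist_mul f 0 = 0.
Proof. by apply: (addrI (twist_mul f 0)); rewrite -twist_mulDr !addr0. Qed.

Lemma twist_mul_filteredl g : filtered (twist_mul^~ g).
Proof.
by have [l gl] := laurent_bound g; exists l => k f fk; exact: twist_mul_below.
Qed.

Lemma twist_mul_filteredr f : filtered (twist_mul f).
Proof.
have [m fm] := laurent_bound f; exists m => k g gk; rewrite addrC.
exact: twist_mul_below.
Qed.

(** In degree m + l only i = m and k = 0 contribute, so leading coefficients multiply; over a field
    this makes the degree additive. *)
Lemma twist_mul_lead f g m (l : int) : (forall i, w i 0 = 1) ->
  below m f -> below l g -> twist_mul f g (m + l) = f m * g l.
Proof.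
move=> w1 fm gl; rewrite /= (twist_coefE (r := [:: (m, 0%N)])) // => [|[i k]].
  by rewrite big_seq1 /twist_term /= mul0r addr0 w1 mul1r addrAC subrr add0r.
rewrite inE xpair_eqE negb_and => ik; apply: (twist_term0 fm gl).
have [|im] := ltP m i; [by left|right].
have [k0|k0] := posnP k; last by have := natz_le_mul nu_gt0 k; lia.
by rewrite k0 orbF in ik *; lia.
Qed.

(** Progressions of step [nu] are stable under products with monomials, so both bracketings of three
    monomials become series of this kind and can be compared coefficientwise. *)
Lemma twist_mul_mono_arith a i (v : nat -> L) m :
  twist_mul (lmono a i) (arith_series nu v m) =
  arith_series nu (fun N => \sum_(k < N.+1) w i k * a * iter k D (v (N - k)%N)) (i + m).
Proof.
apply: arith_seriesP => // [N|n nim] /=; last first.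
  rewrite (twist_coefE (r := [::])) ?big_nil // => -[j k] _; rewrite /twist_term /=.
  case: eqP => [->|_]; last by rewrite mulr0 mul0r.
  rewrite [X in iter _ _ X](arith_series_out nu_gt0) ?iterD0 ?mulr0 // => q E.
  by apply: (nim (k + q)%N); rewrite PoszD mulrDl; lia.
rewrite (twist_coefE (r := [seq (i, k) | k <- iota 0 N.+1])) => [||[j k] jkr].
- rewrite big_map -(big_mkord xpredT (fun k => w i k * a * iter k D (v (N - k)%N))).
  rewrite /index_iota subn0; apply: eq_big_seq => k.
  rewrite mem_iota add0n ltnS => kN; rewrite -(arith_seriesE nu_gt0 v m).
  rewrite /twist_term [lcoef (lmono _ _) _]/= eqxx -subzn // mulrBl.
  by congr (_ * _ * iter k D (lcoef _ _)); rewrite /=; ring.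
- by rewrite map_inj_uniq ?iota_uniq // => k p [].
rewrite /twist_term /=; case: eqP => [ji|_]; last by rewrite mulr0 mul0r.
rewrite {}ji in jkr *; rewrite [X in iter _ _ X](arith_series_out nu_gt0).
  by rewrite iterD0 mulr0.
move=> q E; case/negP: jkr; apply/mapP; exists k => //; rewrite mem_iota add0n ltnS /=.
by nia.
Qed.

Lemma twist_mul_arith_mono (u : nat -> L) m e (l : int) :
  twist_mul (arith_series nu u m) (lmono e l) =
  arith_series nu (fun N => \sum_(p < N.+1)
    w (m - p%:Z * nu) (N - p) * u p * iter (N - p) D e) (m + l).
Proof.
apply: arith_seriesP => // [N|n nml] /=; last first.
  rewrite (twist_coefE (r := [::])) ?big_nil // => -[j k] _; rewrite /twist_term /=.
  case: eqP => [E|_]; last by rewrite iterD0 mulr0.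
  rewrite [X in _ * X * _](arith_series_out nu_gt0) ?mulr0 ?mul0r // => q F.
  by apply: (nml (k + q)%N); rewrite PoszD mulrDl; lia.
rewrite (twist_coefE (r := [seq (m - p%:Z * nu, (N - p)%N) | p <- iota 0 N.+1])).
- rewrite big_map -(big_mkord xpredT (fun p =>
    w (m - p%:Z * nu) (N - p) * u p * iter (N - p) D e)).
  rewrite /index_iota subn0; apply: eq_big_seq => p.
  rewrite mem_iota add0n ltnS /twist_term [fst _]/= [snd _]/= => pN.
  by rewrite arith_seriesE //= -subzn // ifT //; apply/eqP; ring.
- by rewrite map_inj_uniq ?iota_uniq // => p q [] E _; apply: (mulz_inj nu_gt0); lia.
move=> [j k] jkr; rewrite /twist_term /=.
case: eqP => [E|_]; last by rewrite iterD0 mulr0.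
rewrite [X in _ * X * _](arith_series_out nu_gt0) ?mulr0 ?mul0r // => q F.
case/negP: jkr; apply/mapP; exists q; rewrite ?mem_iota ?add0n ?ltnS /=.
  by nia.
by congr (_, _) => //; nia.
Qed.

Lemma twist_mul_mono a i b j : twist_mul (lmono a i) (lmono b j) =
  arith_series nu (fun k => w i k * a * iter k D b) (i + j).
Proof.
pose v k : L := if k is 0 then b else 0.
have -> : lmono b j = arith_series nu v j by rewrite arith_series_lmono // => -[].
rewrite twist_mul_mono_arith; apply: eq_arith_series => N.
rewrite big_ord_recr /= subnn big1 ?add0r // => k _.
by rewrite /v; case: subn (subn_gt0 k N) (ltn_ord k) => [<-//|q _ _];
  rewrite iterD0 mulr0.
Qed.

Hypothesis DM : forall y z, D (y * z) = D y * z + y * D z.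
Hypothesis w_i0 : forall i, w i 0 = 1.
Hypothesis w_0k : forall k, w 0 k.+1 = 0.
Hypothesis Dw : forall i k y, D (w i k * y) = w i k * D y.
(** Compares the coefficients of a D^p(b) D^(N - p)(e) in the two bracketings of a T^i . b T^j . e
    T^l. *)
Hypothesis w_conv : forall i j N p, (p <= N)%N ->
  \sum_(p <= k < N.+1) w i k * 'C(k, p)%:R * w j (N - k) =
  w i p * w (i + j - p%:Z * nu) (N - p).

Lemma iterDw i k p y : iter p D (w i k * y) = w i k * iter p D y.
Proof. by elim: p => // p IH; rewrite !iterS IH Dw. Qed.

Lemma twist_mul_mono_assoc a i b j e (l : int) :
  twist_mul (lmono a i) (twist_mul (lmono b j) (lmono e l)) =
  twist_mul (twist_mul (lmono a i) (lmono b j)) (lmono e l).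
Proof.
rewrite !twist_mul_mono twist_mul_mono_arith twist_mul_arith_mono addrA.
apply: eq_arith_series => N.
pose T k p := w i k * 'C(k, p)%:R * w j (N - k) *
  (a * iter p D b * iter (N - p) D e).
(* The range of p in the Leibniz rule is extended from k to N by zero binomials, so that the two
   sums can be exchanged. *)
transitivity (\sum_(k < N.+1) \sum_(p < N.+1) T k p).
  apply: eq_bigr => k _; rewrite -!(big_mkord xpredT (T k)).
  rewrite (big_cat_nat _ (ltn_ord k)) //= [X in _ + X]big_nat_cond.
  rewrite [X in _ + X]big1 ?addr0; last first.
    by move=> p /andP[/andP[kp _] _]; rewrite /T bin_small // mulr0 !mul0r.
  rewrite -[w j _ * b * _]mulrA iterDw iterD_leibniz // big_mkord !mulr_sumr.
  apply: eq_bigr => p _; rewrite /T -iterD.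
  have -> : (k - p + (N - k) = N - p)%N by have := ltn_ord p; have := ltn_ord k; lia.
  ring.
rewrite exchange_big; apply: eq_bigr => p _ /=.
rewrite -mulr_suml -(big_mkord xpredT (fun k => w i k * 'C(k, p)%:R * w j (N - k))).
rewrite (big_cat_nat _ (ltnW (ltn_ord p))) //= big_nat_cond big1 ?add0r; last first.
  by move=> k /andP[/andP[_ kp] _]; rewrite bin_small // mulr0 !mul0r.
by rewrite w_conv -1?ltnS //; ring.
Qed.

Lemma twist_mulA : associative twist_mul.
Proof.
move=> f g h; pose lD := twist_mulDl; pose rD := twist_mulDr.
pose lF := twist_mul_filteredl; pose rF := twist_mul_filteredr.
apply: (filtered_ext (phi := fun f => twist_mul f (twist_mul g h))
  (psi := fun f => twist_mul (twist_mul f g) h)) => [x y|x y|||a i].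
- exact: lD.
- by rewrite !lD.
- exact: lF.
- exact: (filtered_comp (lF h) (lF g)).
apply: (filtered_ext (phi := fun g => twist_mul (lmono a i) (twist_mul g h))
  (psi := fun g => twist_mul (twist_mul (lmono a i) g) h)) => [x y|x y|||b j].
- by rewrite lD rD.
- by rewrite rD lD.
- exact: (filtered_comp (rF _) (lF h)).
- exact: (filtered_comp (lF h) (rF _)).
apply: (filtered_ext (phi := fun h => twist_mul (lmono a i) (twist_mul (lmono b j) h))
  (psi := fun h => twist_mul (twist_mul (lmono a i) (lmono b j)) h))
  => [x y|x y|||e l].
- by rewrite !rD.
- exact: rD.
- exact: (filtered_comp (rF _) (rF _)).
- exact: rF.
exact: twist_mul_mono_assoc.
Qed.

Lemma twist_mul_powr a i j : twist_mul (lmono a i) (lmono 1 j) = lmono a (i + j).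
Proof.
have D1 : D 1 = 0.
  by apply: (addrI (D 1)); rewrite addr0 -{3}[1](mulr1 1) DM mulr1 mul1r.
rewrite twist_mul_mono arith_series_lmono //= ?w_i0 ?mulr1 ?mul1r // => -[|k] // _.
by rewrite iterSr D1 iterD0 mulr0.
Qed.

Lemma twist_mul_scalar b f : twist_mul (lmono b 0) f = b *: f.
Proof.
apply: laurentP => n /=.
rewrite (twist_coefE (r := [:: (0, 0%N)])) // => [|[i [|k]]].
- by rewrite big_seq1 /twist_term /= w_i0 mul1r subr0 mul0r addr0.
- rewrite inE xpair_eqE andbT => /negPf i0.
  by rewrite /twist_term /= i0 mulr0 mul0r.
by move=> _; rewrite /twist_term /=; case: eqP => [->|_]; rewrite ?w_0k ?(mulr0, mul0r).
Qed.

Lemma twist_mul_deg f g : ldeg (twist_mul f g) = (ldeg f + ldeg g)%E.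
Proof.
have [->|f0] := eqVneq f 0.
  by rewrite twist_mul0l ldeg0 addNye.
have [->|g0] := eqVneq g 0.
  by rewrite twist_mul0r ldeg0 addeNy.
have [m fm0 fm] := laurent_lead f0; have [l gl0 gl] := laurent_lead g0.
rewrite (ldeg_lead fm0 fm) (ldeg_lead gl0 gl) -EFinD; apply: ldeg_lead.
  by rewrite (twist_mul_lead w_i0 fm gl) mulf_neq0.
exact: twist_mul_below.
Qed.

Lemma twist_mul_continuous :
  continuous (fun q : laurent L * laurent L => twist_mul q.1 q.2).
Proof.
move=> [f g] U /nbhs_laurentP[k kU].
have [m fm] := laurent_bound f; have [l gl] := laurent_bound g.
(* Below, [g'] is only known to be below max l (k - m): d <= k - l handles the first bound and d <=
   m the second. *)
pose d := Num.min m (k - l).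
exists ([set f' | below d (f - f')], [set g' | below (k - m) (g - g')]) => /=.
  by split; apply/nbhs_laurentP; [exists d|exists (k - m)].
move=> [f' g'] /= [ff' gg']; apply: kU.
have -> : twist_mul f g - twist_mul f' g' =
    twist_mul (f - f') g' + twist_mul f (g - g').
  have := twist_mulDl (f - f') f' g'; have := twist_mulDr f (g - g') g'.
  by rewrite !subrK => -> ->; rewrite addrA addrK addrC.
have g'l : below (Num.max l (k - m)) g'.
  rewrite -[g'](subKr g); apply: belowB.
    by apply: below_le gl; rewrite le_max lexx.
  by apply: below_le gg'; rewrite le_max lexx orbT.
apply: belowD.
  by apply: below_le (twist_mul_below ff' g'l); rewrite /d; lia.
by apply: below_le (twist_mul_below fm gg'); lia.
Qed.

Lemma twist_mul_deformed : deformed_laurent_ring twist_mul.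
Proof.
split; [exact: twist_mulA|exact: twist_mulDl|exact: twist_mulDr
  |exact: twist_mul_continuous|exact: twist_mul_scalar|move=> i j
  |exact: twist_mul_deg].
exact: twist_mul_powr.
Qed.

Lemma has_sum_twist_mul f g : has_sum (fun q : int * int =>
  twist_mul (lmono (f q.1) q.1) (lmono (g q.2) q.2)) (twist_mul f g).
Proof.
apply: has_sum_below => k.
have [m fm] := laurent_bound f; have [l gl] := laurent_bound g.
(* Each cut-off is matched to the degree bound of the other factor, so that both error products are
   below k. *)
have [rf [rf_uniq rfm] [rfP rfk]] := below_trunc (k - l) fm.
have [rg [rg_uniq rgl] [rgP rgk]] := below_trunc (k - m) gl.
exists [seq (i, j) | i <- rf, j <- rg].
  by apply: allpairs_uniq => // -[? ?] [? ?].
split=> [[i j] /= ijr|].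
  have [mi|im] := ltP m i.
    by rewrite fm // lmono0 twist_mul0l.
  have [lj|jl] := ltP l j.
    by rewrite gl // lmono0 twist_mul0r.
  apply: below_le (twist_mul_below (@below_lmono _ (f i) i) (@below_lmono _ (g j) j)).
  rewrite leNgt; apply: contraNN ijr => kij; apply/allpairsP; exists (i, j).
  by split=> //=; [apply: rfP|apply: rgP]; lia.
rewrite big_allpairs /=.
set f0 := \sum_(i <- rf) _ in rfk; set g0 := \sum_(i <- rg) _ in rgk.
have -> : \sum_(i <- rf) \sum_(j <- rg) twist_mul (lmono (f i) i) (lmono (g j) j) =
    twist_mul f0 g0.
  rewrite /f0 (big_morph (twist_mul^~ g0) (fun x y => twist_mulDl x y g0)
    (twist_mul0l g0)).
  apply: eq_bigr => i _.
  by rewrite (big_morph _ (twist_mulDr (lmono (f i) i)) (twist_mul0r _)).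
have -> : twist_mul f g - twist_mul f0 g0 =
    twist_mul (f - f0) g + twist_mul f0 (g - g0).
  have := twist_mulDl (f - f0) f0 g; have := twist_mulDr f0 (g - g0) g0.
  by rewrite !subrK => -> ->; rewrite !addrA addrK.
apply: belowD.
  by apply: below_le (twist_mul_below rfk gl); lia.
have f0m : below m f0.
  rewrite /f0 big_seq; apply: below_sum => i /rfm im.
  by apply: below_le (@below_lmono _ (f i) i).
by apply: below_le (twist_mul_below f0m rgk); lia.
Qed.

End TwistedMultiplication.

(** * A deformed Laurent series ring is determined by its commutation rule *)

Section Uniqueness.
Variable L : fieldType.
Implicit Types (f g x : laurent L) (a b : L) (i j k m : int).

Section DeformedRing.
Variable mul : laurent L -> laurent L -> laurent L.
Hypothesis mulP : deformed_laurent_ring mul.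

(** Additivity of the degree makes any such product filtered in each argument, which opens the way
    to [filtered_ext]. *)
Lemma dlr_below f g k m : below k f -> below m g -> below (k + m) (mul f g).
Proof.
move=> /below_ldeg fk /below_ldeg gm; apply: ldeg_below.
by rewrite (dlr_deg mulP) EFinD; exact: leeD.
Qed.

Lemma dlr_filteredl g : filtered (mul^~ g).
Proof. by have [m gm] := laurent_bound g; exists m => k f fk; exact: dlr_below. Qed.

Lemma dlr_filteredr f : filtered (mul f).
Proof.
by have [m fm] := laurent_bound f; exists m => k g gk; rewrite addrC; exact: dlr_below.
Qed.

Lemma dlr_lmono a i : mul (lmono a 0) (lmono 1 i) = lmono a i.
Proof. by rewrite (dlr_scalar mulP) scale_lmono mulr1. Qed.

Lemma dlr_powr a i j : mul (lmono a i) (lmono 1 j) = lmono a (i + j).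
Proof.
by rewrite -dlr_lmono -(dlr_assoc mulP) (dlr_powers mulP) dlr_lmono.
Qed.

Lemma dlr_powK i x : mul (lmono 1 i) (mul (lmono 1 (- i)) x) = x.
Proof. by rewrite (dlr_assoc mulP) dlr_powr subrr (dlr_scalar mulP) scale1r. Qed.

End DeformedRing.

(* The products T . b determine those T . f, hence the T^i . f by associativity
   and invertibility of T; additivity of the degree reduces everything else to
   monomials. *)
Lemma deformed_laurent_ring_ext mul mul' :
  deformed_laurent_ring mul -> deformed_laurent_ring mul' ->
  (forall b, mul (lmono 1 1) (lmono b 0) = mul' (lmono 1 1) (lmono b 0)) ->
  mul =2 mul'.
Proof.
move=> mulP mulP' eqT.
have T1 : mul (lmono 1 1) =1 mul' (lmono 1 1).
  apply: (filtered_ext (dlr_distrr mulP _) (dlr_distrr mulP' _)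
    (dlr_filteredr mulP _) (dlr_filteredr mulP' _)) => b j.
  rewrite -{1}(dlr_lmono mulP b j) -(dlr_lmono mulP' b j) (dlr_assoc mulP).
  rewrite (dlr_assoc mulP') eqT; move: (mul' _ _).
  (* Right multiplication by a power of T is the same shift of monomials in both rings. *)
  apply: (filtered_ext (phi := mul^~ (lmono 1 j)) (psi := mul'^~ (lmono 1 j)))
    => [x y|x y|||a i].
  - exact: (dlr_distrl mulP).
  - exact: (dlr_distrl mulP').
  - exact: dlr_filteredl.
  - exact: dlr_filteredl.
  - by rewrite (dlr_powr mulP) (dlr_powr mulP').
have Tn (n : nat) : mul (lmono 1 n%:Z) =1 mul' (lmono 1 n%:Z).
  elim: n => [|n IH] x; first by rewrite (dlr_scalar mulP) (dlr_scalar mulP').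
  rewrite -(addn1 n) PoszD addrC -{1}(dlr_powr mulP) -(dlr_assoc mulP) IH T1.
  by rewrite (dlr_assoc mulP') (dlr_powr mulP').
have Ti i : mul (lmono 1 i) =1 mul' (lmono 1 i).
  move=> x; case: (intP i) => [|n|n]; [exact: (Tn 0%N)|exact: Tn|].
  have := dlr_powK mulP n.+1%:Z x; rewrite Tn => E.
  by rewrite -[LHS](dlr_powK mulP' (- n.+1%:Z)) opprK E.
move=> f g; move: f; apply: (filtered_ext (phi := mul^~ g) (psi := mul'^~ g))
  => [x y|x y|||a i].
- exact: (dlr_distrl mulP).
- exact: (dlr_distrl mulP').
- exact: dlr_filteredl.
- exact: dlr_filteredl.
rewrite -{1}(dlr_lmono mulP a i) -(dlr_lmono mulP' a i) -(dlr_assoc mulP).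
by rewrite -(dlr_assoc mulP') (dlr_scalar mulP) (dlr_scalar mulP') Ti.
Qed.

End Uniqueness.

(* Over an abstract field, since [field] would unfold the fractions of [ratfun]. *)
Lemma quotient_rule (F : fieldType) (a b u v a' b' u' v' : F) :
  b != 0 -> v != 0 ->
  ((a' * u + a * u') * (b * v) - a * u * (b' * v + b * v')) / (b * v * (b * v)) =
  (a' * b - a * b') / (b * b) * (u / v) + a / b * ((u' * v - u * v') / (v * v)).
Proof. by move=> b0 v0; field; rewrite b0 v0. Qed.

Lemma ratderivM (K : fieldType) (f g : ratfun K) :
  ratderiv (f * g) = ratderiv f * g + f * ratderiv g.
Proof.
rewrite (ratfun_repr f) (ratfun_repr g).
have := denom_ratioP (repr f); have := denom_ratioP (repr g).
move: (\n_(repr f)) (\d_(repr f)) (\n_(repr g)) (\d_(repr g)) => a b u v /=.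
move=> v0 b0.
have vF : ratfun_poly v != 0 by rewrite ratfun_poly_eq0.
have bF : ratfun_poly b != 0 by rewrite ratfun_poly_eq0.
rewrite mulf_div -!ratfun_polyM !ratderiv_frac ?mulf_neq0 //.
rewrite !expr2 !derivM !rmorphB /= !ratfun_polyM !ratfun_polyD !ratfun_polyM.
exact (@quotient_rule (ratfun K) _ _ _ _ _ _ _ _ bF vF).
Qed.

(** * The weights of the product over K(alpha), and the identities for the operators delta_i *)

Section Weights.
Variables (K : fieldType) (nu s : int).
Hypothesis charK : [pchar K] =i pred0.
Hypothesis nu_gt0 : 0 < nu.
Implicit Types (i j : int) (k p N m : nat).

(** The common form of the coefficients of [delta] (at i = 1, by [dcoef_weight]) and of [lam] (by
    [lam_weight]). *)
Definition weight i k : K :=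
  (nu%:~R / s%:~R) ^+ k * gbinom (i%:~R / nu%:~R) k.

Let nuK : (nu%:~R : K) != 0 := intf_neq0 charK (lt0r_neq0 nu_gt0).

Lemma weight_i0 i : weight i 0 = 1.
Proof. by rewrite /weight gbinom0 mulr1. Qed.

Lemma weight_0k k : weight 0 k.+1 = 0.
Proof. by rewrite /weight mul0r gbinom0l mulr0. Qed.

(** A degree drop of p nu lowers the binomial argument by p, exactly the shift in
    [trinomial_sum]. *)
Lemma weight_shift i p : (i - p%:Z * nu)%:~R / nu%:~R = i%:~R / nu%:~R - p%:R :> K.
Proof. by rewrite rmorphB rmorphM /= mulrBl mulfK. Qed.

Lemma weight_conv i j N p : (p <= N)%N ->
  \sum_(p <= k < N.+1) weight i k * 'C(k, p)%:R * weight j (N - k) =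
  weight i p * weight (i + j - p%:Z * nu) (N - p).
Proof.
move=> pN; rewrite /weight weight_shift rmorphD /= mulrDl.
move: (i%:~R / _) (j%:~R / _) (_ / s%:~R) => x y c.
rewrite mulrACA -exprD subnKC // addrAC -trinomial_sum // mulr_sumr.
apply: eq_big_nat => k /andP[_ kN].
have -> : c ^+ N = c ^+ k * c ^+ (N - k) by rewrite -exprD subnKC.
by ring.
Qed.

Lemma weight_trinomial i N p : (p <= N)%N ->
  weight i N * 'C(N, p)%:R = weight i p * weight (i - p%:Z * nu) (N - p).
Proof.
move=> pN; rewrite /weight weight_shift mulrACA -exprD subnKC //.
by rewrite -gbinom_trinomial // -mulrA.
Qed.

(** Each factor 1 - i nu equals nu (1 / nu - i). *)
Lemma dcoef_weight k : dcoef K nu s k / k`!%:R = weight 1 k.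
Proof.
rewrite /dcoef /weight /gbinom mulrA; congr (_ / _).
have -> : \prod_(0 <= i < k) (1 - i%:R * nu%:~R) =
    nu%:~R ^+ k * \prod_(0 <= i < k) (1%:~R / nu%:~R - i%:R) :> K.
  rewrite -[k in nu%:~R ^+ k]subn0 -prodr_const_nat -big_split.
  by apply: eq_bigr => i _ /=; field.
by rewrite mulrA -exprVn -exprMn [_^-1 * _]mulrC.
Qed.

(** This is [gbinom_lagrange] at x = 1 / nu; k = 0 is separate because the interpolating sum is then
    empty. *)
Lemma lam_weight i k : lam K nu s i k = weight i k.
Proof.
rewrite /lam; case: eqP => [->|/eqP]; first by rewrite weight_i0.
rewrite -lt0n => k0; rewrite /weight -gbinom_lagrange //; congr (_ * _).
by apply: eq_bigr => l _; rewrite !rmorphB.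
Qed.

Lemma delta_weight k (f : ratfun K) :
  delta nu s (1 - k%:Z * nu) f = weight 1 k *: iter k (@ratderiv K) f.
Proof. by rewrite deltaE // dcoef_weight. Qed.

Lemma delta_neq0 i (f : ratfun K) : delta nu s i f != 0 ->
  exists k, i = 1 - k%:Z * nu.
Proof.
rewrite /delta; case: ifP; last by rewrite eqxx.
move=> /andP[i1 /dvdzP[q qE]] _; exists `|q|%N.
by rewrite gez0_abs -?qE ?subKr // -(pmulr_lge0 _ nu_gt0) -qE subr_ge0.
Qed.

Lemma foldr_delta_neq0 (js : seq int) (f : ratfun K) :
  foldr (delta nu s) f js != 0 -> exists ns, js = [seq 1 - (n : nat)%:Z * nu | n <- ns].
Proof.
elim: js => [|j js IH] /= d0; first by exists [::].
have [k ->] := delta_neq0 d0.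
have [|ns ->] := IH; last by exists (k :: ns).
by apply: contraNneq d0 => ->; rewrite linear0.
Qed.

Lemma iter_ratderivZ k (c : K) (f : ratfun K) :
  iter k (@ratderiv K) (c *: f) = c *: iter k (@ratderiv K) f.
Proof. by elim: k => // k IH; rewrite !iterS IH linearZ. Qed.

Lemma foldr_delta (ns : seq nat) (f : ratfun K) :
  foldr (delta nu s) f [seq 1 - (n : nat)%:Z * nu | n <- ns] =
  ((nu%:~R / s%:~R) ^+ sumn ns * \prod_(n <- ns) gbinom (nu%:~R^-1) n)
    *: iter (sumn ns) (@ratderiv K) f.
Proof.
elim: ns => [|n ns IH] /=; first by rewrite big_nil mulr1 scale1r.
rewrite IH delta_weight iter_ratderivZ scalerA -iterD big_cons exprD /weight.
by congr (_ *: _); rewrite mul1r; ring.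
Qed.

(** The -k in the index condition cancels the ones in the degrees 1 - n nu, so that the condition
    becomes p + n_1 + ... + n_k = N. *)
Lemma sum_degrees (ns : seq nat) :
  \sum_(j <- [seq 1 - n%:Z * nu | n <- ns]) j - (size ns)%:Z = - (sumn ns)%:Z * nu.
Proof.
elim: ns => [|n ns IH]; first by rewrite big_nil mul0r.
by move/(canRL (subrK _)): IH => IH; rewrite /= big_cons IH -add1n !PoszD; ring.
Qed.

(* Only the pairs with l = 1 - p nu and j_m = 1 - n_m nu contribute; grouping
   them by p, the sum over (n_1, ..., n_k) is that of [gbinom_compositions]. *)
Lemma leibniz_sum N (a b : ratfun K) :
  \sum_(q \in leibniz_index (1 - N%:Z * nu))
    gbinom (q.1%:~R : K) (size q.2)
      *: (delta nu s q.1 a * foldr (delta nu s) b q.2) =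
  \sum_(1 <= p < N) (weight 1 N * 'C(N, p)%:R)
    *: (iter p (@ratderiv K) a * iter (N - p) (@ratderiv K) b).
Proof.
pose deg n : int := 1 - (n : nat)%:Z * nu.
have deg_inj : injective deg.
  by move=> m n /addrI/oppr_inj/(mulz_inj nu_gt0).
(* Nonpositive degrees force p and all parts n to be at least 1, and k > 0 forces p < N. *)
pose r := [seq (deg p, [seq deg n | n <- ns]) | p <- iota 1 N.-1,
                                                 ns <- compositions (N - p)].
have rP p ns : ((deg p, [seq deg n | n <- ns]) \in r) =
    [&& (0 < p < N)%N, sumn ns == (N - p)%N & all (leq 1) ns].
  apply/allpairsPdep/idP.
    move=> [p' [ns' [+ + [/deg_inj -> /(inj_map deg_inj) ->]]]].
    rewrite mem_iota mem_compositions => h1 h2.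
    by apply/andP; split; [lia|].
  move=> /andP[pN h]; exists p, ns; rewrite mem_iota mem_compositions.
  by split=> //; lia.
have rS : [set` r] `<=` leibniz_index (1 - N%:Z * nu).
  case=> l js /allpairsPdep[p [ns [+ + [-> ->]]]].
  rewrite mem_iota mem_compositions => pN /andP[/eqP nsE ns1] /=; split => /=.
  + by rewrite size_map lt0n size_eq0; apply: contraTneq pN => ns0; move: nsE;
    rewrite ns0 /=; lia.
  + by rewrite /deg; nia.
  + by move=> _ /mapP[n /(allP ns1) /= n1 ->]; rewrite /deg; nia.
  + by rewrite size_map sum_degrees nsE /deg -subzn; [ring|lia].
rewrite (fsbigE r) => [|||q]; first last.
- case: q => l js [/= js0 l0 jsn0 E] lr; apply/eqP; rewrite scaler_eq0.
  apply/norP => -[_]; rewrite mulf_eq0 negb_or => /andP[/delta_neq0[p lE]].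
  move=> /foldr_delta_neq0[ns jsE]; move: lr; rewrite {}lE {}jsE in js0 l0 jsn0 E *.
  rewrite rP => /negP; apply.
  have p0 : (0 < p)%N by case: p l0 {E} => //; rewrite mul0r subr0.
  have ns1 : all (leq 1) ns.
    apply/allP => n nns; have := jsn0 _ (map_f deg nns).
    by case: n {nns} => //; rewrite /deg mul0r subr0.
  have sE : (sumn ns + p)%N = N.
    apply: (mulz_inj nu_gt0); move: E; rewrite size_map sum_degrees PoszD; nia.
  have ns0 : (0 < sumn ns)%N.
    case: ns js0 ns1 {jsn0 E sE} => // n ns _ /= /andP[n1 _].
    by rewrite addn_gt0 n1.
  by rewrite ns1 andbT; lia.
- exact: rS.
- apply: allpairs_uniq_dep => [|p _|]; first exact: iota_uniq.
    exact: compositions_uniq.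
  move=> [p ns] [p' ns'] _ _ /= [] /deg_inj -> /(inj_map deg_inj) ->.
  by [].
transitivity (\sum_(q <- r) gbinom (q.1%:~R : K) (size q.2)
      *: (delta nu s q.1 a * foldr (delta nu s) b q.2)).
  rewrite big_seq_cond [RHS]big_seq; apply: eq_bigl => q.
  by apply: andb_idr => qr; apply/mem_set/rS.
rewrite big_allpairs_dep /index_iota subn1; apply: eq_big_seq => p.
rewrite mem_iota => pN /=.
pose c : K := nu%:~R / s%:~R.
pose X := iter p (@ratderiv K) a * iter (N - p) (@ratderiv K) b.
transitivity (\sum_(ns <- compositions (N - p)) (weight 1 p * c ^+ (N - p) *
    (gbinom ((deg p)%:~R : K) (size ns) * \prod_(n <- ns) gbinom (nu%:~R^-1) n)) *: X).
  apply: eq_big_seq => ns; rewrite mem_compositions => /andP[/eqP nsE _].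
  rewrite size_map delta_weight foldr_delta nsE -scalerAl -scalerAr !scalerA.
  by congr (_ *: _); rewrite /c; ring.
(* With l = 1 - p nu and x = 1 / nu, the inner sum and the power of c combine to
   [weight (1 - p nu) (N - p)]. *)
rewrite -scaler_suml -mulr_sumr gbinom_compositions // -mulrA.
by rewrite weight_trinomial //; lia.
Qed.

Lemma delta_leibniz i (a b : ratfun K) : i <= 0 ->
  delta nu s i (a * b) = a * delta nu s i b + delta nu s i a * b
    + \sum_(q \in leibniz_index i) gbinom (q.1%:~R : K) (size q.2)
        *: (delta nu s q.1 a * foldr (delta nu s) b q.2).
Proof.
move=> i0; have [[N iE]|/forallNP iN] := pselect (exists k : nat, i = 1 - k%:Z * nu).
  have N0 : (0 < N)%N by case: N iE => // iE; move: i0; rewrite iE mul0r subr0.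
  rewrite iE leibniz_sum !delta_weight (iterD_leibniz (@ratderivM K)) scaler_sumr.
  pose F p := weight 1 N *: ('C(N, p)%:R * (iter p (@ratderiv K) a * iter
    (N - p) (@ratderiv K) b)).
  (* The terms p = 0 and p = N of the Leibniz rule are the two products outside the sum in the
     claim. *)
  rewrite -(big_mkord xpredT F) big_nat_recr // big_ltn // {1 3}/F /=.
  rewrite bin0 binn !mul1r subn0 subnn /= addrAC.
  congr (_ + _ + _); [by rewrite scalerAr|by rewrite scalerAl|].
  by apply: eq_bigr => p _; rewrite /F -scalerA scaler_nat mulr_natl.
(* Off the progression everything vanishes: a nonzero summand would put i itself on it. *)
have d0 (f : ratfun K) : delta nu s i f = 0.
  by apply/eqP/negPn/negP => /delta_neq0[k /iN].
rewrite !d0 mulr0 mul0r !add0r fsbig1 // => -[l js] [/= _ _ _ E].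
apply/eqP; rewrite scaler_eq0; apply/norP => -[_].
rewrite mulf_eq0 negb_or => /andP[/delta_neq0[p lE] /foldr_delta_neq0[ns jsE]].
apply: (iN (p + sumn ns)%N); rewrite -E jsE size_map sum_degrees lE PoszD mulrDl; lia.
Qed.

End Weights.

(** * The deformed Laurent series ring over K(alpha) *)

Section RationalFunctionSeries.
Variables (K : fieldType) (nu s : int).
Hypothesis charK : [pchar K] =i pred0.
Hypothesis nu_gt0 : 0 < nu.
Implicit Types (i j m : int) (k : nat) (f a b : ratfun K).

Lemma arith_series_recl (L : fieldType) (u : nat -> L) m :
  arith_series nu u m = lmono (u 0%N) m + arith_series nu (fun k => u k.+1) (m - nu).
Proof.
apply/esym/arith_seriesP => [//|[|k]|j jm]; rewrite lcoefD.
- rewrite mul0r subr0 [lcoef (lmono _ _) _]/= eqxx arith_series_out ?addr0 // => k.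
  by have := natz_le_mul nu_gt0 k; lia.
- rewrite [lcoef (lmono _ _) _]/= ifF; last first.
    by apply/eqP; have := natz_le_mul nu_gt0 k.+1; lia.
  have -> : m - k.+1%:Z * nu = m - nu - k%:Z * nu by rewrite -add1n PoszD; ring.
  by rewrite arith_seriesE ?add0r.
rewrite [lcoef (lmono _ _) _]/= ifF; last first.
  by apply/eqP => jE; apply: (jm 0%N); rewrite jE mul0r subr0.
rewrite arith_series_out ?addr0 // => k jE; apply: (jm k.+1).
by rewrite jE -add1n PoszD; ring.
Qed.

(** Sums are unique, so the rule amounts to an explicit series for each T . f, the form that the
    uniqueness argument uses. *)
Lemma commutation_ruleP mul : deformed_laurent_ring mul ->
  commutation_rule nu s mul <-> forall f, mul (lmono 1 1) (lmono f 0) =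
    arith_series nu (fun k => weight K nu s 1 k *: iter k (@ratderiv K) f) 1.
Proof.
move=> mulP; pose u f k := weight K nu s 1 k *: iter k (@ratderiv K) f.
have sumS f : has_sum (fun k : nat => mul (lmono (delta nu s (1 - k.+1%:Z * nu) f) 0)
    (lmono 1 (1 - k.+1%:Z * nu))) (arith_series nu (fun k => u f k.+1) (1 - nu)).
  rewrite (_ : (fun k => _) = fun k : nat => lmono (u f k.+1) (1 - nu - k%:Z * nu)).
    exact: has_sum_arith_series.
  apply/funext => k; rewrite (dlr_lmono mulP) delta_weight //; congr (lmono _ _).
  by rewrite -add1n PoszD; ring.
have recl f : arith_series nu (u f) 1 =
    mul (lmono f 0) (lmono 1 1) + arith_series nu (fun k => u f k.+1) (1 - nu).
  by rewrite arith_series_recl (dlr_lmono mulP) /u weight_i0 scale1r.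
split=> [rule f|rule f];
  last by exists (arith_series nu (fun k => u f k.+1) (1 - nu)); rewrite // rule recl.
by have [S FS ->] := rule f; rewrite (has_sum_unique FS (sumS f)) -recl.
Qed.

(** The weights are constants of K, embedded in K(alpha) by [%:A]; the derivation therefore commutes
    with them. *)
Definition ratfun_mul := twist_mul (@ratderiv K)
  (fun i k => (weight K nu s i k)%:A) nu_gt0.

Lemma ratfun_mul_deformed : deformed_laurent_ring ratfun_mul.
Proof.
apply: twist_mul_deformed => [f g|i|k|i k f|i j N p pN].
- exact: ratderivM.
- by rewrite weight_i0 // scale1r.
- by rewrite weight_0k // scale0r.
- by rewrite !mulr_algl; exact: linearZ.
pose h : {rmorphism K -> ratfun K} := in_alg (ratfun K).
have := congr1 h (weight_conv s charK nu_gt0 i j pN).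
rewrite rmorph_sum rmorphM => <-; apply: eq_bigr => k _.
by rewrite rmorphM [h (_ * _%:R)]rmorphM rmorph_nat.
Qed.

Lemma ratfun_mul_lmono a i b j : ratfun_mul (lmono a i) (lmono b j) =
  arith_series nu (fun k => weight K nu s i k *: (a * iter k (@ratderiv K) b)) (i + j).
Proof.
rewrite /ratfun_mul twist_mul_mono; apply: eq_arith_series => k.
by rewrite -mulrA mulr_algl.
Qed.

Lemma ratfun_mul_commutation : commutation_rule nu s ratfun_mul.
Proof.
apply/(commutation_ruleP ratfun_mul_deformed) => f.
rewrite ratfun_mul_lmono addr0; apply: eq_arith_series => k.
by rewrite mul1r.
Qed.

Lemma ratfun_mul_unique mul : deformed_laurent_ring mul ->
  commutation_rule nu s mul -> mul = ratfun_mul.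
Proof.
move=> mulP /(commutation_ruleP mulP) ruleT.
apply/funext => f; apply/funext => g; move: f g.
apply: (deformed_laurent_ring_ext mulP ratfun_mul_deformed) => b.
rewrite ruleT; apply/esym.
exact: (proj1 (commutation_ruleP ratfun_mul_deformed) ratfun_mul_commutation b).
Qed.

End RationalFunctionSeries.

Theorem proposition4p1 (K : fieldType) (charK : [pchar K] =i pred0)
    (r s nu : int) (s_neq0 : s != 0) (nuE : nu = r + s) (nu_gt0 : 0 < nu) :
  [/\ (* the identities satisfied by the delta_i, i <= 0 *)
      forall (i : int) (a b : ratfun K), i <= 0 ->
        delta nu s i (a * b) =
          a * delta nu s i b + delta nu s i a * b
          + \sum_(p \in leibniz_index i)
              gbinom (p.1%:~R : K) (size p.2)
                *: (delta nu s p.1 a * foldr (delta nu s) b p.2),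
      (* existence of the deformed Laurent series ring *)
      exists mul : laurent (ratfun K) -> laurent (ratfun K) ->
                   laurent (ratfun K),
        deformed_laurent_ring mul /\ commutation_rule nu s mul,
      (* the first terms of the commutation rule *)
      forall f : ratfun K,
        delta nu s (1 - nu) f = s%:~R^-1 *: ratderiv f
        /\ delta nu s (1 - 2 * nu) f =
             ((2`!)%:R^-1 * ((1 - nu%:~R) / s%:~R ^+ 2))
               *: iter 2 (@ratderiv K) f,
      (* the multiplication of any such ring *)
      forall mul : laurent (ratfun K) -> laurent (ratfun K) ->
                   laurent (ratfun K),
        deformed_laurent_ring mul -> commutation_rule nu s mul ->
        (* terms with i or j above the degrees of f and g vanish *)
        (forall f g : laurent (ratfun K),
           has_sum
             (fun p : int * int => mul (lmono (f p.1) p.1) (lmono (g p.2) p.2))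
             (mul f g))
        /\ (forall (a b : ratfun K) (i j : int),
              has_sum
                (fun k : nat =>
                   lmono (lam K nu s i k *: (a * iter k (@ratderiv K) b))
                         (i - k%:Z * nu + j))
                (mul (lmono a i) (lmono b j)))
    & r = 0 -> s = 1 ->
      forall (i : int) (k : nat), lam K nu s i k = gbinom i%:~R k].
Proof.
split.
- by move=> i a b; exact: delta_leibniz.
- exists (ratfun_mul s nu_gt0); split; last exact: ratfun_mul_commutation.
  exact: ratfun_mul_deformed.
- move=> f; split.
    have -> : 1 - nu = 1 - 1%:Z * nu by rewrite mul1r.
    rewrite deltaE // /dcoef big_nat1 mul0r subr0 mulr1.
    by rewrite expr1 divr1.
  rewrite (_ : 1 - 2 * nu = 1 - 2%:Z
    * nu) // deltaE // /dcoef big_nat_recr //= big_nat1 mul0r subr0 !mul1r.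
  by congr (_ *: _); rewrite mulrC [_ ^- 2 * _]mulrC.
(* By uniqueness it suffices to prove both formulas for [ratfun_mul]. *)
- move=> mul mulP rule; rewrite (ratfun_mul_unique charK nu_gt0 mulP rule).
  split=> [f g|a b i j]; first exact: has_sum_twist_mul.
  rewrite ratfun_mul_lmono //.
  rewrite (_ : (fun k => _) = fun k : nat => lmono (weight K nu s i k *:
    (a * iter k (@ratderiv K) b)) (i + j - k%:Z * nu)).
    exact: has_sum_arith_series.
  by apply/funext => k; rewrite lam_weight // addrAC.
(* Here nu = s = 1, so the power of nu / s is 1 and the binomial argument is i. *)
move=> r0 s1 i k; rewrite lam_weight // /weight nuE r0 s1 add0r.
by rewrite !divr1 expr1n mul1r.
Qed.
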